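(* Let $\alpha\in(0,1)$ and let $0=t_0<t_1<\dots<t_M=T$ be a temporal mesh satisfying $\sigma_j\ge\sigma_{j+1}\ge0$ for all $j\ge2$, where $\tau_j:=t_j-t_{j-1}$ and $\sigma_j:=\frac{\tau_j-\tau_{j-1}}{\tau_j+\tau_{j-1}}\in[0,1)$. Set $$\mathcal A:=\frac{\alpha+2}{(1-\alpha)(2-\alpha)},\qquad \mathcal B':=\frac{4\alpha}{(1-\alpha)(2-\alpha)},\qquad \nu:=1-\tfrac1{48}(1-\alpha),$$ and for any $\theta\in[\frac12,1]$ set $$\eta(\sigma):=(1-\sigma^2)\Bigl[\frac{\mathcal A}{\mathcal B'}-\frac{\sigma}{2(1+\sigma)}\Bigr],\qquad \beta_j:=\frac{\theta\,\nu}{2\,\eta(\sigma_j)}\quad\forall\,j\ge2,\qquad \beta_1:=\beta_2\qquad(\beta_0:=0).$$ Then $\beta_j\ge\beta_{j+1}>0$ for all $j\ge1$. Furthermore, for any $\theta\in[\frac12,1]$ there exists $\bar\sigma=\bar\sigma(\alpha,\theta)\in(0,1)$ (independent of the mesh) such that if $\sigma_j\in[0,\bar\sigma]$ for all $j\ge2$, then $\beta_j\in(0,1)$ for all $j\ge1$, and the coefficients $\kappa_{m,j}$ in the representation $$\delta_t^\alpha U^m=\sum_{j=0}^m \kappa_{m,j}V^j\quad (1\le m\le M),\qquad V^0:=U^0,\qquad V^j:=\frac{U^j-\beta_jU^{j-1}}{1-\beta_j}\quad (1\le j\le M)$$ satisfy $$\kappa_{m,m}>0\ \text{ and }\ \sum_{j=0}^m\kappa_{m,j}=0\quad\forall\,1\le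 m\le M,\qquad \kappa_{m,j}\le0\quad\forall\,0\le j<m\le M.$$
   Context: The mesh condition means $\sigma_2\ge\sigma_3\ge\dots\ge\sigma_M\ge0$. For a continuous, piecewise smooth function $w$, $D_t^\alpha w(t):=\frac1{\Gamma(1-\alpha)}\int_0^t(t-s)^{-\alpha}w'(s)\,ds$ (Caputo derivative). For mesh values $\{U^j\}_{j=0}^M$, $\Pi^mU$ is the following continuous piecewise polynomial interpolant on $[0,t_m]$. For $m=1$ it is the linear Lagrange interpolant at $t_0,t_1$. For $m\ge2$, on $(t_{j-1},t_j)$ with $1\le j<m$ it is the quadratic Lagrange interpolant at $t_{j-1},t_j,t_{j+1}$, and on $(t_{m-1},t_m)$ it is the quadratic Lagrange interpolant at $t_{m-2},t_{m-1},t_m$. The discrete fractional-derivative operator is $\delta_t^\alpha U^m:=D_t^\alpha(\Pi^mU)(t_m)$, $1\le m\le M$. The coefficients $\kappa_{m,j}$ are uniquely determined by requiring the representation to hold for all $\{U^j\}$. *)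

(* Defs.v *)
From Stdlib Require Import Reals.
From Coquelicot Require Import Coquelicot.
Open Scope R_scope.

Definition Gamma (z : R) : R :=
  RInt_gen (fun x => Rpower x (z - 1) * exp (- x))
    (at_right 0) (Rbar_locally p_infty).

(** Caputo derivative at [x > 0]. The integrand is singular at [s = x], so the
    integral is improper there; [Derive w] may take any value at the finitely
    many kinks of a piecewise smooth [w] without changing the integral. *)
Definition caputo (alpha : R) (w : R -> R) (x : R) : R :=
  / Gamma (1 - alpha) *
  RInt_gen (fun s => Rpower (x - s) (- alpha) * Derive w s)
    (at_point 0) (at_left x).

Definition is_mesh (t : nat -> R) (M : nat) (T : R) : Prop :=
  t 0%nat = 0 /\ (forall j, (j < M)%nat -> t j < t (S j)) /\ t M = T.

(** Meaningful for [1 <= j]. *)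
Definition tau_mesh (t : nat -> R) (j : nat) : R := t j - t (j - 1)%nat.

(** Meaningful for [2 <= j]. *)
Definition sigma_mesh (t : nat -> R) (j : nat) : R :=
  (tau_mesh t j - tau_mesh t (j - 1)%nat) / (tau_mesh t j + tau_mesh t (j - 1)%nat).

Definition mesh_condition (t : nat -> R) (M : nat) : Prop :=
  (forall j, (2 <= j)%nat -> (j < M)%nat -> sigma_mesh t (S j) <= sigma_mesh t j) /\
  (forall j, (2 <= j <= M)%nat -> 0 <= sigma_mesh t j).

Definition lagrange1 (x0 x1 y0 y1 s : R) : R :=
  y0 * ((s - x1) / (x0 - x1)) + y1 * ((s - x0) / (x1 - x0)).

Definition lagrange2 (x0 x1 x2 y0 y1 y2 s : R) : R :=
  y0 * (((s - x1) * (s - x2)) / ((x0 - x1) * (x0 - x2))) +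
  y1 * (((s - x0) * (s - x2)) / ((x1 - x0) * (x1 - x2))) +
  y2 * (((s - x0) * (s - x1)) / ((x2 - x0) * (x2 - x1))).

(** For [1 <= m] and [s] in [[t 0, t m]], the [j] in [1..m] with
    [t (j - 1) < s <= t j] (and [1] for [s = t 0]). *)
Fixpoint piece (t : nat -> R) (m : nat) (s : R) : nat :=
  match m with
  | S (S _ as k) => if Rle_dec s (t k) then piece t k s else S k
  | _ => 1%nat
  end.

(** The interpolant [Pi^m U] on [[0, t m]]. For [2 <= m] the middle node of the
    stencil on the [j]-th interval is [t j], except that it is [t (m - 1)] on
    the last interval. *)
Definition interp (t : nat -> R) (m : nat) (U : nat -> R) (s : R) : R :=
  match m with
  | O => U 0%nat
  | 1%nat => lagrange1 (t 0%nat) (t 1%nat) (U 0%nat) (U 1%nat) s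
  | _ =>
      let c := Nat.min (piece t m s) (m - 1) in
      lagrange2 (t (c - 1)%nat) (t c) (t (c + 1)%nat)
                (U (c - 1)%nat) (U c) (U (c + 1)%nat) s
  end.

Definition delta (alpha : R) (t : nat -> R) (m : nat) (U : nat -> R) : R :=
  caputo alpha (interp t m U) (t m).

Definition coefA (alpha : R) : R := (alpha + 2) / ((1 - alpha) * (2 - alpha)).
Definition coefB' (alpha : R) : R := (4 * alpha) / ((1 - alpha) * (2 - alpha)).
Definition nu (alpha : R) : R := 1 - / 48 * (1 - alpha).

Definition eta (alpha s : R) : R :=
  (1 - s ^ 2) * (coefA alpha / coefB' alpha - s / (2 * (1 + s))).

Definition beta (alpha theta : R) (t : nat -> R) (j : nat) : R :=
  match j with
  | O => 0
  | 1%nat => theta * nu alpha / (2 * eta alpha (sigma_mesh t 2))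
  | _ => theta * nu alpha / (2 * eta alpha (sigma_mesh t j))
  end.

Definition Vseq (b U : nat -> R) (j : nat) : R :=
  match j with
  | O => U 0%nat
  | S i => (U (S i) - b (S i) * U i) / (1 - b (S i))
  end.

(** [kappa m j] are coefficients of [delta^alpha U^m] with respect to
    [V^0, ..., V^m], valid for all mesh values [U]. *)
Definition represents (alpha : R) (t : nat -> R) (M : nat) (b : nat -> R)
    (kappa : nat -> nat -> R) : Prop :=
  forall (m : nat) (U : nat -> R), (1 <= m <= M)%nat ->
    delta alpha t m U = sum_f_R0 (fun j => kappa m j * Vseq b U j) m.

(* Main.v *)
Require Import Defs.
From Stdlib Require Import Reals Lra Lia.
From Coquelicot Require Import Coquelicot.
Open Scope R_scope.

(** Up to the factor [Gamma (1 - alpha)], [delta^alpha U^m] is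
    [sum_k g_k (U^k - U^(k-1))] with explicit weights [g_k], [g_0 = 0], and
    [kappa_(m,j) = (1 - beta_j) h_j] where [h_m = g_m] and
    [h_j = g_j - g_(j+1) + beta_(j+1) h_(j+1)]. So it suffices that [g_m > 0], that
    [h_(m-1)] and [h_(m-2)] are nonpositive, and that [g_j <= g_(j+1)] for
    [j <= m - 3]. The last point follows from the convexity of [x^(-alpha)] when
    consecutive steps have ratio at least 4/5. For the other two, [g_m] and the main
    part of [g_(m-1)] are [(tau_(m-1) + tau_m)^(-alpha)] times rational functions of
    [tau_(m-1) / tau_m], so that both signs reduce to rational inequalities in
    [sigma_m] and [beta_m]. These are strict at [sigma_m = 0], hence hold for small
    [sigma_m]. *)

(** * Integrals of the kernel *)

(** The difficulty is that one [sbar] must serve every mesh, although [h_(m-2)] contains both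
    [beta_(m-1)] and [beta_m] and, through [g_(m-2)], steps further back. Two one-sided bounds
    remove this dependence. As [h_(m-1) <= 0] and [beta] is nonincreasing,
    [beta_(m-1) h_(m-1) <= beta_m h_(m-1)]; and for nondecreasing steps
    [g_(m-2) <= (tau_(m-1) + tau_m)^(-alpha)]. What is left depends on [sigma_m] alone, so
    continuity in one real variable at [0] produces [sbar], with no explicit value. There the sign
    of [h_(m-2)] is the delicate one: at [theta = 1/2] its margin tends to [0] as [alpha] tends to
    [1], which is where the lower limit on [theta] and the closeness of [nu] to [1] matter. *)

Lemma is_RInt_antiderivative (F f : R -> R) (u v : R) :
  u <= v ->
  (forall y, u <= y <= v -> is_derive F y (f y)) ->
  (forall y, u <= y <= v -> ex_derive f y) ->
  is_RInt f u v (F v - F u).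
Proof.
  intros Huv HF Hf.
  apply (is_RInt_derive F f u v); rewrite Rmin_left, Rmax_right by lra; auto.
  intros y Hy. apply (ex_derive_continuous (K := R_AbsRing) (V := R_NormedModule)).
  auto.
Qed.

Lemma Rpower_opp_decreasing (alpha x y : R) :
  0 <= alpha -> 0 < x <= y -> Rpower y (- alpha) <= Rpower x (- alpha).
Proof.
  intros Ha Hxy. rewrite !Rpower_Ropp.
  apply Rinv_le_contravar; [apply exp_pos | apply Rle_Rpower_l; lra].
Qed.

(* Bernoulli: [(v / u)^(-alpha) = exp (- alpha ln (v / u)) >= 1 - alpha (v / u - 1)]. *)
Lemma Rpower_opp_tangent (alpha u v : R) :
  0 <= alpha -> 0 < u -> 0 < v ->
  Rpower u (- alpha) - alpha * Rpower u (- alpha) / u * (v - u)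
    <= Rpower v (- alpha).
Proof.
  intros Ha Hu Hv.
  assert (Hq : 0 < v / u) by (apply Rdiv_lt_0_compat; lra).
  replace v with (u * (v / u)) at 2 by (field; lra).
  rewrite <- Rpower_mult_distr by lra.
  pose proof (exp_pos (- alpha * ln u)) as HP. fold (Rpower u (- alpha)) in HP.
  assert (H1 : 1 + - alpha * ln (v / u) <= Rpower (v / u) (- alpha))
    by apply exp_ineq1_le.
  assert (H2 : ln (v / u) <= v / u - 1).
  { pose proof (exp_ineq1_le (ln (v / u))) as H. rewrite exp_ln in H by lra. lra. }
  replace (Rpower u (- alpha) - alpha * Rpower u (- alpha) / u * (v - u))
    with (Rpower u (- alpha) * (1 - alpha * (v / u - 1))) by (field; lra).
  apply Rmult_le_compat_l; nra.
Qed.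

Lemma Rpower_opp_slope_decreasing (alpha x y : R) :
  0 <= alpha -> 0 < x <= y ->
  alpha * Rpower y (- alpha) / y <= alpha * Rpower x (- alpha) / x.
Proof.
  intros Ha Hxy.
  pose proof (Rpower_opp_decreasing alpha x y Ha Hxy).
  pose proof (exp_pos (- alpha * ln y)) as HP. fold (Rpower y (- alpha)) in HP.
  unfold Rdiv. apply Rmult_le_compat; try nra.
  - left. apply Rinv_0_lt_compat; lra.
  - apply Rinv_le_contravar; lra.
Qed.

(** The tangent at [y] bounds both end values from below, and the weights [X - y] and [y - x] cancel
    its slope. *)
Lemma Rpower_opp_chord (alpha x X y : R) :
  0 <= alpha -> 0 < x < X -> x <= y <= X ->
  Rpower y (- alpha) <=
    Rpower x (- alpha) +
    (Rpower X (- alpha) - Rpower x (- alpha)) / (X - x) * (y - x).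
Proof.
  intros Ha HxX Hy.
  pose proof (Rpower_opp_tangent alpha y x Ha ltac:(lra) ltac:(lra)) as H1.
  pose proof (Rpower_opp_tangent alpha y X Ha ltac:(lra) ltac:(lra)) as H2.
  set (s := alpha * Rpower y (- alpha) / y) in *.
  apply Rmult_le_reg_r with (X - x); [lra|].
  replace ((Rpower x (- alpha) + (Rpower X (- alpha) - Rpower x (- alpha)) / (X - x) * (y - x)) * (X - x))
    with (Rpower x (- alpha) * (X - y) + Rpower X (- alpha) * (y - x))
    by (field; lra).
  nra.
Qed.

(* Antiderivatives of [x^(-alpha)] and of [x^(1 - alpha)]. Writing them as
   products with [x] gives them the right value [0] at [x = 0], although
   [Rpower 0 _ = 1]. *)
Definition kprim0 (alpha x : R) : R := x * Rpower x (- alpha) / (1 - alpha).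
Definition kprim1 (alpha x : R) : R := x ^ 2 * Rpower x (- alpha) / (2 - alpha).

Lemma kprim0_derive (alpha x : R) :
  alpha < 1 -> 0 < x -> is_derive (kprim0 alpha) x (Rpower x (- alpha)).
Proof.
  intros Ha Hx. unfold kprim0, Rpower. auto_derive; [lra|]. field. lra.
Qed.

Lemma kprim1_derive (alpha x : R) :
  alpha < 2 -> 0 < x -> is_derive (kprim1 alpha) x (x * Rpower x (- alpha)).
Proof.
  intros Ha Hx. unfold kprim1, Rpower. auto_derive; [lra|]. field. lra.
Qed.

(* With [s = t_m - y], [x = t_m - t_k] and [X = t_m - t_(k-1)], these are the
   integrals of [(t_m - s)^(-alpha)] and of
   [(t_m - s)^(-alpha) (2 s - t_(k-1) - t_k)] over [[t_(k-1), t_k]]. *)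
Definition kint0 (alpha x X : R) : R := kprim0 alpha X - kprim0 alpha x.
Definition kint1 (alpha x X : R) : R :=
  (X + x) * kint0 alpha x X - 2 * (kprim1 alpha X - kprim1 alpha x).

Lemma is_RInt_kint0 (alpha x X : R) :
  alpha < 1 -> 0 < x < X ->
  is_RInt (fun y => Rpower y (- alpha)) x X (kint0 alpha x X).
Proof.
  intros Ha Hx. apply (is_RInt_antiderivative (kprim0 alpha)); [lra| |].
  - intros y Hy. apply kprim0_derive; lra.
  - intros y Hy. unfold Rpower. auto_derive. lra.
Qed.

Lemma is_RInt_kint1 (alpha x X : R) :
  alpha < 1 -> 0 < x < X ->
  is_RInt (fun y => (X + x - 2 * y) * Rpower y (- alpha)) x X (kint1 alpha x X).
Proof.
  intros Ha Hx.
  replace (kint1 alpha x X) with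
    (((X + x) * kprim0 alpha X - 2 * kprim1 alpha X) -
     ((X + x) * kprim0 alpha x - 2 * kprim1 alpha x))
    by (unfold kint1, kint0; ring).
  apply (is_RInt_antiderivative
           (fun y => (X + x) * kprim0 alpha y - 2 * kprim1 alpha y)); [lra| |].
  - intros y Hy.
    replace ((X + x - 2 * y) * Rpower y (- alpha)) with
      ((X + x) * Rpower y (- alpha) - 2 * (y * Rpower y (- alpha))) by ring.
    apply (is_derive_minus (K := R_AbsRing) (V := R_NormedModule)
             (fun y => (X + x) * kprim0 alpha y) (fun y => 2 * kprim1 alpha y));
      apply is_derive_scal;
      [apply kprim0_derive | apply kprim1_derive]; lra.
  - intros y Hy. unfold Rpower. auto_derive. lra.
Qed.

Lemma kint0_ge (alpha x X : R) :
  0 <= alpha < 1 -> 0 < x < X ->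
  (X - x) * Rpower X (- alpha) <= kint0 alpha x X.
Proof.
  intros Ha Hx.
  apply (is_RInt_le (fun _ => Rpower X (- alpha)) (fun y => Rpower y (- alpha)) x X).
  - lra.
  - apply (is_RInt_const x X (Rpower X (- alpha))).
  - apply is_RInt_kint0; lra.
  - intros y Hy. apply Rpower_opp_decreasing; lra.
Qed.

Lemma kint0_le_trapezoid (alpha x X : R) :
  0 <= alpha < 1 -> 0 < x < X ->
  kint0 alpha x X <=
    (X - x) * ((Rpower x (- alpha) + Rpower X (- alpha)) / 2).
Proof.
  intros Ha Hx.
  set (c := (Rpower X (- alpha) - Rpower x (- alpha)) / (X - x)).
  apply (is_RInt_le (fun y => Rpower y (- alpha))
           (fun y => Rpower x (- alpha) + c * (y - x)) x X).
  - lra.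
  - apply is_RInt_kint0; lra.
  - replace ((X - x) * ((Rpower x (- alpha) + Rpower X (- alpha)) / 2)) with
      ((Rpower x (- alpha) * X + c * (X - x) ^ 2 / 2) -
       (Rpower x (- alpha) * x + c * (x - x) ^ 2 / 2))
      by (unfold c; field; lra).
    apply (is_RInt_antiderivative
             (fun y => Rpower x (- alpha) * y + c * (y - x) ^ 2 / 2)); [lra| |];
      intros y Hy; auto_derive; auto; field.
  - intros y Hy. apply Rpower_opp_chord; lra.
Qed.

(** The affine factor is odd about the midpoint, so the midpoint value [c] of the kernel integrates
    to [0] against it; the decreasing kernel is at least [c] where the factor is positive and at
    most [c] where it is negative. *)
Lemma kint1_ge0 (alpha x X : R) :
  0 <= alpha < 1 -> 0 < x < X -> 0 <= kint1 alpha x X.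
Proof.
  intros Ha Hx.
  set (c := Rpower ((X + x) / 2) (- alpha)).
  apply (is_RInt_le (fun y => (X + x - 2 * y) * c)
           (fun y => (X + x - 2 * y) * Rpower y (- alpha)) x X).
  - lra.
  - replace 0 with (((X + x) * X - X ^ 2) * c - ((X + x) * x - x ^ 2) * c) by ring.
    apply (is_RInt_antiderivative (fun y => ((X + x) * y - y ^ 2) * c)); [lra| |];
      intros y Hy; auto_derive; auto; ring.
  - apply is_RInt_kint1; lra.
  - intros y Hy. unfold c.
    destruct (Rle_dec y ((X + x) / 2)) as [H|H].
    + pose proof (Rpower_opp_decreasing alpha y ((X + x) / 2)). nra.
    + pose proof (Rpower_opp_decreasing alpha ((X + x) / 2) y). nra.
Qed.

Lemma kint1_le_kint0 (alpha x X : R) :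
  0 <= alpha < 1 -> 0 < x < X -> kint1 alpha x X <= (X - x) * kint0 alpha x X.
Proof.
  intros Ha Hx.
  apply (is_RInt_le (fun y => (X + x - 2 * y) * Rpower y (- alpha))
           (fun y => scal (X - x) (Rpower y (- alpha))) x X).
  - lra.
  - apply is_RInt_kint1; lra.
  - apply (is_RInt_scal (V := R_NormedModule)). apply is_RInt_kint0; lra.
  - intros y Hy. unfold scal; simpl; unfold mult; simpl.
    apply Rmult_le_compat_r; [left; apply exp_pos | lra].
Qed.

(** Subtracting the midpoint value [c] costs nothing, by oddness. The kernel differs from [c] by at
    most [L] times the distance to the midpoint, which leaves [(X + x - 2 y)^2 L / 2], with integral
    [L (X - x)^3 / 6]. *)
Lemma kint1_le (alpha x X : R) :
  0 <= alpha < 1 -> 0 < x < X ->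
  kint1 alpha x X <= alpha * Rpower x (- alpha) / x * (X - x) ^ 3 / 6.
Proof.
  intros Ha Hx.
  set (c := Rpower ((X + x) / 2) (- alpha)).
  set (L := alpha * Rpower x (- alpha) / x).
  apply (is_RInt_le (fun y => (X + x - 2 * y) * Rpower y (- alpha))
           (fun y => (X + x - 2 * y) * c + (X + x - 2 * y) ^ 2 / 2 * L) x X).
  - lra.
  - apply is_RInt_kint1; lra.
  - replace (L * (X - x) ^ 3 / 6) with
      ((((X + x) * X - X ^ 2) * c - (X + x - 2 * X) ^ 3 / 12 * L) -
       (((X + x) * x - x ^ 2) * c - (X + x - 2 * x) ^ 3 / 12 * L)) by field.
    apply (is_RInt_antiderivative
             (fun y => ((X + x) * y - y ^ 2) * c - (X + x - 2 * y) ^ 3 / 12 * L));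
      [lra| |]; intros y Hy; auto_derive; auto; field.
  - intros y Hy. set (h := (X + x) / 2) in *.
    replace (X + x - 2 * y) with (2 * (h - y)) by (unfold h; field).
    assert (Hh : x < h < X) by (unfold h; lra).
    pose proof (Rpower_opp_tangent alpha y h ltac:(lra) ltac:(lra) ltac:(lra)).
    pose proof (Rpower_opp_tangent alpha h y ltac:(lra) ltac:(lra) ltac:(lra)).
    pose proof (Rpower_opp_slope_decreasing alpha x y ltac:(lra) ltac:(lra)).
    pose proof (Rpower_opp_slope_decreasing alpha x h ltac:(lra) ltac:(lra)).
    fold L in H1, H2. fold c in H, H0, H2.
    set (k := Rpower y (- alpha)) in *.
    destruct (Rle_dec y h) as [Hyh|Hyh].
    + assert (k - c <= (h - y) * L) by nra. nra.
    + assert (c - k <= (y - h) * L) by nra. nra.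
Qed.

(** * The rational inequalities *)

(** One parabola serves the last two intervals, so its derivative is a single affine function on
    [[t_(m-2), t_m]] and the terms at the break point [t_(m-1)], powers of [tau], cancel. Those at
    [t_m] vanish because [kprim0] and [kprim1] are [0] at [0]. *)
Lemma last_weight_eq (alpha tau rho : R) :
  0 < alpha < 1 -> 0 < tau -> 0 < rho ->
  (kint0 alpha 0 tau +
   (kint1 alpha tau (tau + rho) + kint1 alpha 0 tau) / (rho + tau)) / tau =
  Rpower (tau + rho) (- alpha) / ((1 - alpha) * (2 - alpha)) *
    (2 + alpha * (rho / tau)).
Proof.
  intros Ha Ht Hr. unfold kint1, kint0, kprim0, kprim1. field. lra.
Qed.

(** The same cancellation, for [g_(m-1)] without the contribution of the stencil centred at
    [t_(m-2)]. *)
Lemma penultimate_weight_eq (alpha tau rho : R) :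
  0 < alpha < 1 -> 0 < tau -> 0 < rho ->
  (kint0 alpha tau (tau + rho) -
   (kint1 alpha tau (tau + rho) + kint1 alpha 0 tau) / (rho + tau)) / rho =
  Rpower (tau + rho) (- alpha) / ((1 - alpha) * (2 - alpha)) *
    (2 - 2 * alpha - alpha / (rho / tau)).
Proof.
  intros Ha Ht Hr. unfold kint1, kint0, kprim0, kprim1. field. lra.
Qed.

Definition beta_of_sigma (alpha theta s : R) : R :=
  theta * nu alpha / (2 * eta alpha s).

Lemma eta_pos (alpha s : R) : 0 < alpha < 1 -> 0 <= s < 1 -> 0 < eta alpha s.
Proof.
  intros Ha Hs. unfold eta, coefA, coefB'.
  apply Rmult_lt_0_compat; [nra|].
  replace ((alpha + 2) / ((1 - alpha) * (2 - alpha)) /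
           (4 * alpha / ((1 - alpha) * (2 - alpha))) - s / (2 * (1 + s)))
    with (((alpha + 2) * (1 + s) - 2 * alpha * s) / (4 * alpha * (1 + s)))
    by (field; lra).
  apply Rdiv_lt_0_compat; nra.
Qed.

Lemma eta_eq (alpha s : R) :
  0 < alpha < 1 -> 0 <= s < 1 ->
  eta alpha s = (1 - s) * (alpha + 2 + s * (2 - alpha)) / (4 * alpha).
Proof.
  intros Ha Hs. unfold eta, coefA, coefB'. field. lra.
Qed.

Lemma eta_decreasing (alpha s s' : R) :
  0 < alpha < 1 -> 0 <= s -> s <= s' -> s' < 1 -> eta alpha s' <= eta alpha s.
Proof.
  intros Ha Hs Hss Hs'. rewrite !eta_eq by lra.
  unfold Rdiv. apply Rmult_le_compat_r.
  - left. apply Rinv_0_lt_compat. lra.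
  (* This product is [4 * alpha] times [eta alpha s - eta alpha s']. *)
  - assert (0 <= (s' - s) * (2 * alpha + (s + s') * (2 - alpha))).
    { apply Rmult_le_pos; [lra|].
      assert (0 <= (s + s') * (2 - alpha)) by (apply Rmult_le_pos; lra). lra. }
    nra.
Qed.

Lemma theta_nu_bounds (alpha theta : R) :
  0 < alpha < 1 -> / 2 <= theta <= 1 ->
  nu alpha / 2 <= theta * nu alpha <= nu alpha /\ 47 / 48 < nu alpha < 1.
Proof.
  intros Ha Ht. assert (H : 47 / 48 < nu alpha < 1) by (unfold nu; lra).
  split; nra.
Qed.

Lemma beta_of_sigma_pos (alpha theta s : R) :
  0 < alpha < 1 -> / 2 <= theta <= 1 -> 0 <= s < 1 ->
  0 < beta_of_sigma alpha theta s.
Proof.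
  intros Ha Ht Hs. pose proof (eta_pos alpha s Ha Hs).
  pose proof (theta_nu_bounds alpha theta Ha Ht).
  unfold beta_of_sigma. apply Rdiv_lt_0_compat; lra.
Qed.

Lemma beta_of_sigma_increasing (alpha theta s s' : R) :
  0 < alpha < 1 -> / 2 <= theta <= 1 -> 0 <= s -> s <= s' -> s' < 1 ->
  beta_of_sigma alpha theta s <= beta_of_sigma alpha theta s'.
Proof.
  intros Ha Ht Hs Hss Hs'.
  pose proof (eta_pos alpha s' Ha ltac:(lra)).
  pose proof (eta_decreasing alpha s s' Ha Hs Hss Hs').
  pose proof (theta_nu_bounds alpha theta Ha Ht).
  unfold beta_of_sigma, Rdiv. apply Rmult_le_compat_l; [lra|].
  apply Rinv_le_contravar; lra.
Qed.

(** For such [s] one has [2 * eta > 1], hence the quotient is below [theta * nu < 1]. The bound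
    [1 / 9] comes from the step ratios and is not sharp here. *)
Lemma beta_of_sigma_lt1 (alpha theta s : R) :
  0 < alpha < 1 -> / 2 <= theta <= 1 -> 0 <= s <= 1 / 9 ->
  beta_of_sigma alpha theta s < 1.
Proof.
  intros Ha Ht Hs.
  pose proof (eta_pos alpha s Ha ltac:(lra)) as He.
  pose proof (theta_nu_bounds alpha theta Ha Ht).
  assert (1 < 2 * eta alpha s).
  { rewrite eta_eq in * by lra.
    apply Rmult_lt_reg_r with (4 * alpha); [lra|].
    replace (2 * ((1 - s) * (alpha + 2 + s * (2 - alpha)) / (4 * alpha)) *
             (4 * alpha))
      with (2 * (1 - s) * (alpha + 2 + s * (2 - alpha))) by (field; lra).
    nra. }
  unfold beta_of_sigma. apply Rmult_lt_reg_r with (2 * eta alpha s); [lra|].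
  unfold Rdiv. rewrite Rmult_assoc, Rinv_l by lra. lra.
Qed.

Definition ratio_of_sigma (s : R) : R := (1 - s) / (1 + s).

(* Up to the factor [Rpower (tau_(m-1) + tau_m) (- alpha) / ((1 - alpha) (2 - alpha))],
   [defect1] and [defect2] dominate the coefficients of [V^(m-1)] and [V^(m-2)];
   [r] is the ratio [tau_(m-1) / tau_m] and [b] stands for [beta_m]. The term
   [alpha / 12] accounts for the stencil centred at [t_(m-2)]. *)
Definition defect1 (alpha r b : R) : R :=
  2 - 2 * alpha - alpha / r + alpha / 12 - (1 - b) * (2 + alpha * r).
Definition defect2 (alpha r b : R) : R :=
  (1 - alpha) * (2 - alpha) - (1 - b) * (2 - 2 * alpha - alpha / r)
  - b * (1 - b) * (2 + alpha * r).

Lemma defects_uniform_mesh (alpha theta : R) :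
  0 < alpha < 1 -> / 2 <= theta <= 1 ->
  defect1 alpha (ratio_of_sigma 0) (beta_of_sigma alpha theta 0) < 0 /\
  defect2 alpha (ratio_of_sigma 0) (beta_of_sigma alpha theta 0) < 0.
Proof.
  intros Ha Ht.
  pose proof (theta_nu_bounds alpha theta Ha Ht) as [Hx Hn].
  set (x := theta * nu alpha) in *.
  assert (Hb : beta_of_sigma alpha theta 0 = 2 * alpha * x / (2 + alpha)).
  { unfold beta_of_sigma. rewrite eta_eq by lra. fold x. field. lra. }
  rewrite Hb.
  replace (ratio_of_sigma 0) with 1 by (unfold ratio_of_sigma; field).
  unfold defect1, defect2. split.
  - replace (2 - 2 * alpha - alpha / 1 + alpha / 12 -
             (1 - 2 * alpha * x / (2 + alpha)) * (2 + alpha * 1))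
      with (alpha * (2 * x - 4 + / 12)) by (field; lra).
    nra.
  - replace ((1 - alpha) * (2 - alpha) -
             (1 - 2 * alpha * x / (2 + alpha)) * (2 - 2 * alpha - alpha / 1) -
             2 * alpha * x / (2 + alpha) * (1 - 2 * alpha * x / (2 + alpha)) *
             (2 + alpha * 1))
      with (alpha ^ 2 * ((2 + alpha - 4 * x * (2 - x)) / (2 + alpha)))
      by (field; lra).
    (* Since [x (2 - x)] increases on [[0, 1]], the worst case is [x = nu / 2], that is
       [theta = 1/2]. With [e = (1 - alpha) / 48] it reads [3 - 48 e < (1 - e) (3 + e)], i.e.
       [e^2 < 46 e]. *)
    assert (2 + alpha < 4 * x * (2 - x)).
    { assert (4 * (nu alpha / 2) * (2 - nu alpha / 2) <= 4 * x * (2 - x)) by nra.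
      assert (2 + alpha < 4 * (nu alpha / 2) * (2 - nu alpha / 2));
        [unfold nu; nra | lra]. }
    assert ((2 + alpha - 4 * x * (2 - x)) / (2 + alpha) < 0).
    { apply Rmult_lt_reg_r with (2 + alpha); [lra|].
      unfold Rdiv. rewrite Rmult_assoc, Rinv_l by lra. lra. }
    pose proof (pow_lt alpha 2 ltac:(lra)).
    rewrite <- (Rmult_0_r (alpha ^ 2)). apply Rmult_lt_compat_l; assumption.
Qed.

Lemma negative_near (f : R -> R) (x : R) :
  ex_derive f x -> f x < 0 -> locally x (fun y => f y < 0).
Proof.
  intros Hf Hx.
  apply (ex_derive_continuous (K := R_AbsRing) (V := R_NormedModule)) in Hf.
  apply (Hf (fun z => z < 0)). apply (open_lt 0). exact Hx.
Qed.

(* [sigma <= 1 / 9] makes consecutive steps have ratio at least 4/5. *)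
Lemma defects_near_uniform_mesh (alpha theta : R) :
  0 < alpha < 1 -> / 2 <= theta <= 1 ->
  exists sbar, 0 < sbar <= 1 / 9 /\ forall s, 0 <= s <= sbar ->
    defect1 alpha (ratio_of_sigma s) (beta_of_sigma alpha theta s) < 0 /\
    defect2 alpha (ratio_of_sigma s) (beta_of_sigma alpha theta s) < 0.
Proof.
  intros Ha Ht.
  destruct (defects_uniform_mesh alpha theta Ha Ht) as [H1 H2].
  assert (He : eta alpha 0 <> 0)
    by (pose proof (eta_pos alpha 0 Ha ltac:(lra)); lra).
  apply (negative_near (fun s => defect1 alpha (ratio_of_sigma s)
    (beta_of_sigma alpha theta s)) 0) in H1.
  (* Differentiability at [0] only asks that [1 + s], the ratio and [eta] be nonzero there. *)
  2:{ unfold defect1, beta_of_sigma, ratio_of_sigma, eta in *. auto_derive.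
      repeat split; lra. }
  apply (negative_near (fun s => defect2 alpha (ratio_of_sigma s)
    (beta_of_sigma alpha theta s)) 0) in H2.
  2:{ unfold defect2, beta_of_sigma, ratio_of_sigma, eta in *. auto_derive.
      repeat split; lra. }
  destruct (filter_and _ _ H1 H2) as [d Hd].
  (* Halving [d] keeps the closed interval inside the open ball of radius [d]. *)
  exists (Rmin (d / 2) (1 / 9)).
  pose proof (cond_pos d). pose proof (Rmin_l (d / 2) (1 / 9)).
  pose proof (Rmin_r (d / 2) (1 / 9)).
  split; [split; [apply Rmin_glb_lt|]; lra|].
  intros s Hs. apply Hd.
  unfold ball; simpl; unfold AbsRing_ball, abs, minus, plus, opp; simpl.
  rewrite Rabs_pos_eq; lra.
Qed.

(** * Change of unknowns from [U] to [V] *)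

(* [transfer b g m k] is the value of [sum_j g_j (W_j - W_(j-1))] at the sequence
   [W] with [W_i = 0] for [i < m - k], [W_(m-k) = 1] and [W_i = b_i W_(i-1)]
   afterwards. *)
Fixpoint transfer (b g : nat -> R) (m k : nat) : R :=
  match k with
  | O => g m
  | S k' => g (m - S k')%nat - g (m - k')%nat + b (m - k')%nat * transfer b g m k'
  end.

Lemma transfer_step (b g : nat -> R) (m j : nat) :
  (j < m)%nat ->
  transfer b g m (m - j) =
    g j - g (S j) + b (S j) * transfer b g m (m - S j).
Proof.
  intros Hj. replace (m - j)%nat with (S (m - S j)) by lia. cbn [transfer].
  replace (m - S (m - S j))%nat with j by lia.
  now replace (m - (m - S j))%nat with (S j) by lia.
Qed.

Lemma weighted_increments_eq (b g U : nat -> R) (m : nat) :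
  b 0%nat = 0 -> g 0%nat = 0 -> (forall j, (1 <= j <= m)%nat -> b j <> 1) ->
  sum_f_R0 (fun j => g j * (U j - U (j - 1)%nat)) m =
  sum_f_R0 (fun j => (1 - b j) * transfer b g m (m - j) * Vseq b U j) m.
Proof.
  intros Hb0 Hg0 Hb.
  (* At stage [n] the coefficient of [U_n] is incomplete, as the next term still brings
     [- g_(n+1) U_n]. Both sides therefore set their [U_n] term aside; replacing [U_(n+1)] by
     [b U_n + (1 - b) V_(n+1)] reproduces the recursion of [transfer], and at [n = m] the two
     corrections coincide. *)
  assert (H : forall n, (n <= m)%nat ->
    sum_f_R0 (fun j => g j * (U j - U (j - 1)%nat)) n - g n * U n =
    sum_f_R0 (fun j => (1 - b j) * transfer b g m (m - j) * Vseq b U j) n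
      - transfer b g m (m - n) * U n).
  { induction n as [|n IH]; intros Hn.
    - cbn [sum_f_R0 Vseq]. rewrite Hb0, Hg0. ring.
    - cbn [sum_f_R0]. specialize (IH ltac:(lia)).
      rewrite (transfer_step b g m n) in IH by lia.
      replace (S n - 1)%nat with n by lia. cbn [Vseq].
      specialize (Hb (S n) ltac:(lia)).
      replace ((1 - b (S n)) * transfer b g m (m - S n) *
               ((U (S n) - b (S n) * U n) / (1 - b (S n))))
        with (transfer b g m (m - S n) * (U (S n) - b (S n) * U n))
        by (field; lra).
      lra. }
  specialize (H m (le_n m)). rewrite Nat.sub_diag in H. cbn [transfer] in H. lra.
Qed.

Lemma transfer_nonpos (b g : nat -> R) (m : nat) :
  (1 <= m)%nat -> (forall j, (1 <= j <= m)%nat -> 0 <= b j) ->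
  g (m - 1)%nat <= (1 - b m) * g m ->
  ((2 <= m)%nat ->
     g (m - 2)%nat - g (m - 1)%nat
       + b (m - 1)%nat * (g (m - 1)%nat - (1 - b m) * g m) <= 0) ->
  (forall j, (j + 3 <= m)%nat -> g j <= g (S j)) ->
  forall j, (j < m)%nat -> transfer b g m (m - j) <= 0.
Proof.
  intros Hm Hb H1 H2 H3.
  assert (T1 : transfer b g m 1 = g (m - 1)%nat - (1 - b m) * g m).
  { cbn [transfer]. rewrite Nat.sub_0_r. ring. }
  assert (H : forall k, (1 <= k <= m)%nat -> transfer b g m k <= 0).
  { induction k as [|k IH]; intros Hk; [lia|].
    destruct (Nat.eq_dec k 0) as [->|Hk0]; [rewrite T1; lra|].
    destruct (Nat.eq_dec k 1) as [->|Hk1].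
    - specialize (H2 ltac:(lia)). rewrite <- T1 in H2. exact H2.
    - cbn [transfer].
      specialize (H3 (m - S k)%nat ltac:(lia)).
      replace (S (m - S k)) with (m - k)%nat in H3 by lia.
      specialize (IH ltac:(lia)). specialize (Hb (m - k)%nat ltac:(lia)). nra. }
  intros j Hj. apply H. lia.
Qed.

Fixpoint Vseq_inv (b V : nat -> R) (j : nat) : R :=
  match j with
  | O => V 0%nat
  | S i => b (S i) * Vseq_inv b V i + (1 - b (S i)) * V (S i)
  end.

Lemma Vseq_invK (b V : nat -> R) (m j : nat) :
  (forall i, (1 <= i <= m)%nat -> b i <> 1) -> (j <= m)%nat ->
  Vseq b (Vseq_inv b V) j = V j.
Proof.
  intros Hb Hj. destruct j as [|j]; [reflexivity|]. cbn.
  specialize (Hb (S j) ltac:(lia)). field. lra.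
Qed.

Lemma Vseq_const (b : nat -> R) (m j : nat) :
  (forall i, (1 <= i <= m)%nat -> b i <> 1) -> (j <= m)%nat ->
  Vseq b (fun _ => 1) j = 1.
Proof.
  intros Hb Hj. destruct j as [|j]; [reflexivity|]. cbn.
  specialize (Hb (S j) ltac:(lia)). field. lra.
Qed.

Lemma sum_f_R0_single (c : nat -> R) (j m : nat) :
  (j <= m)%nat ->
  sum_f_R0 (fun i => c i * (if Nat.eq_dec i j then 1 else 0)) m = c j.
Proof.
  intros Hj. induction m as [|m IH].
  - replace j with 0%nat by lia. cbn. ring.
  - cbn [sum_f_R0]. destruct (Nat.eq_dec (S m) j) as [<-|H].
    + rewrite (sum_eq _ (fun _ => 0)).
      * rewrite sum_cte. ring.
      * intros i Hi. destruct (Nat.eq_dec i (S m)); [lia|ring].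
    + rewrite IH by lia. ring.
Qed.

(** Passing from [U] to [V] is invertible, so [V] may be taken to be a unit sequence, which isolates
    one coefficient. *)
Lemma Vseq_coefficients_unique (b kappa kappa' : nat -> R) (m : nat) :
  (forall i, (1 <= i <= m)%nat -> b i <> 1) ->
  (forall U, sum_f_R0 (fun j => kappa j * Vseq b U j) m =
             sum_f_R0 (fun j => kappa' j * Vseq b U j) m) ->
  forall j, (j <= m)%nat -> kappa j = kappa' j.
Proof.
  intros Hb H j Hj.
  set (V := fun i => if Nat.eq_dec i j then 1 else 0).
  assert (E : forall c, sum_f_R0 (fun i => c i * Vseq b (Vseq_inv b V) i) m = c j).
  { intros c. rewrite <- (sum_f_R0_single c j m Hj). apply sum_eq. intros i Hi.
    now rewrite (Vseq_invK b V m). }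
  specialize (H (Vseq_inv b V)). now rewrite !E in H.
Qed.

(** * Improper integrals and positivity of [Gamma] *)

Lemma is_RInt_gen_of_filterlim_r (f F : R -> R) (u l : R) (Fb : (R -> Prop) -> Prop) :
  Filter Fb ->
  Fb (fun y => is_RInt f u y (F y)) -> filterlim F Fb (locally l) ->
  is_RInt_gen f (at_point u) Fb l.
Proof.
  intros FFb Hint Hlim P HP.
  apply (Filter_prod (at_point u) Fb _ (fun x => x = u)
           (fun y => is_RInt f u y (F y) /\ P (F y))).
  - reflexivity.
  - apply filter_and; [exact Hint | exact (Hlim P HP)].
  - intros x y -> Hy. exists (F y). exact Hy.
Qed.

Lemma is_RInt_gen_of_filterlim_l (f F : R -> R) (u l : R) (Fa : (R -> Prop) -> Prop) :
  Filter Fa ->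
  Fa (fun x => is_RInt f x u (F x)) -> filterlim F Fa (locally l) ->
  is_RInt_gen f Fa (at_point u) l.
Proof.
  intros FFa Hint Hlim P HP.
  apply (Filter_prod Fa (at_point u) _
           (fun x => is_RInt f x u (F x) /\ P (F x)) (fun y => y = u)).
  - apply filter_and; [exact Hint | exact (Hlim P HP)].
  - reflexivity.
  - intros x y Hx ->. exists (F x). exact Hx.
Qed.

Lemma bounded_monotone_filterlim_p_infty (F : R -> R) (u C : R) :
  (forall x y, u <= x <= y -> F x <= F y) -> (forall x, u <= x -> F x <= C) ->
  exists l, F u <= l /\ filterlim F (Rbar_locally p_infty) (locally l).
Proof.
  intros Hmono Hbd.
  destruct (completeness (fun z => exists x, u <= x /\ z = F x)) as [l [Hub Hlub]].
  - exists C. intros z [x [Hx ->]]. auto.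
  - exists (F u). exists u. split; [lra|reflexivity].
  - exists l. split; [apply Hub; exists u; split; [lra|reflexivity]|].
    apply filterlim_locally. intros eps.
    assert (Hx : exists x, u <= x /\ l - eps < F x).
    { apply Classical_Prop.NNPP. intros Hn.
      assert (l <= l - eps); [|pose proof (cond_pos eps); lra].
      apply Hlub. intros z [x [Hx ->]].
      destruct (Rle_dec (F x) (l - eps)); [assumption|].
      exfalso. apply Hn. exists x. lra. }
    destruct Hx as [x [Hx Hl]]. exists x. intros y Hy.
    assert (F y <= l) by (apply Hub; exists y; split; [lra|reflexivity]).
    pose proof (Hmono x y ltac:(lra)).
    unfold ball; simpl; unfold AbsRing_ball, abs, minus, plus, opp; simpl.
    apply Rabs_def1; lra.
Qed.

(** The limit is recorded as a bound at every point, not only at [u], because positivity of [Gamma]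
    uses it at [1/2]. *)
Lemma bounded_monotone_filterlim_at_right (F : R -> R) (u C : R) :
  0 < u ->
  (forall x y, 0 < x <= y -> y <= u -> F y <= F x) ->
  (forall x, 0 < x <= u -> F x <= C) ->
  exists l, (forall x, 0 < x <= u -> F x <= l) /\
    filterlim F (at_right 0) (locally l).
Proof.
  intros Hu Hmono Hbd.
  destruct (completeness (fun z => exists x, 0 < x <= u /\ z = F x)) as [l [Hub Hlub]].
  - exists C. intros z [x [Hx ->]]. auto.
  - exists (F u). exists u. split; [lra|reflexivity].
  - exists l. split; [intros x Hx; apply Hub; now exists x|].
    apply filterlim_locally. intros eps.
    assert (Hx : exists x, 0 < x <= u /\ l - eps < F x).
    { apply Classical_Prop.NNPP. intros Hn.
      assert (l <= l - eps); [|pose proof (cond_pos eps); lra].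
      apply Hlub. intros z [x [Hx ->]].
      destruct (Rle_dec (F x) (l - eps)); [assumption|].
      exfalso. apply Hn. exists x. lra. }
    destruct Hx as [x [Hx Hl]]. exists (mkposreal x (proj1 Hx)). intros y Hy Hy0.
    unfold ball in Hy; simpl in Hy; unfold AbsRing_ball, abs, minus, plus, opp in Hy;
      simpl in Hy.
    apply Rabs_def2 in Hy.
    assert (F y <= l) by (apply Hub; exists y; split; [lra|reflexivity]).
    pose proof (Hmono y x ltac:(lra) ltac:(lra)).
    unfold ball; simpl; unfold AbsRing_ball, abs, minus, plus, opp; simpl.
    apply Rabs_def1; lra.
Qed.

(** The value of [RInt_gen] means something only once convergence is known. The integral is split at
    [1]: the integrand is at most [x^(-alpha)] below [1] and at most [exp (- x)] above. *)
Lemma Gamma_pos (alpha : R) : 0 < alpha < 1 -> 0 < Gamma (1 - alpha).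
Proof.
  intros Ha.
  set (f := fun x => Rpower x (1 - alpha - 1) * exp (- x)).
  assert (Hf0 : forall x, 0 < f x)
    by (intros x; apply Rmult_lt_0_compat; apply exp_pos).
  assert (Hex : forall x y, 0 < x <= y -> ex_RInt f x y).
  { intros x y Hxy. apply (ex_RInt_continuous (V := R_CompleteNormedModule)).
    rewrite Rmin_left, Rmax_right by lra. intros z Hz.
    apply (ex_derive_continuous (K := R_AbsRing) (V := R_NormedModule)).
    unfold f, Rpower. auto_derive. lra. }
  assert (Hpos : forall x y, 0 < x <= y -> 0 <= RInt f x y).
  { intros x y Hxy. apply RInt_ge_0; [lra | now apply Hex |].
    intros z _. left. apply Hf0. }
  assert (HCh : forall x y z, 0 < x <= y -> y <= z ->
             RInt f x z = RInt f x y + RInt f y z).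
  { intros x y z Hxy Hyz. symmetry. 
    apply (RInt_Chasles (V := R_CompleteNormedModule) f x y z); apply Hex; lra. }
  destruct (bounded_monotone_filterlim_p_infty (RInt f 1) 1 (exp (- 1)))
    as [l2 [Hl2 Hlim2]].
  { intros x y Hxy. rewrite (HCh 1 x y) by lra. pose proof (Hpos x y). lra. }
  { intros y Hy. apply Rle_trans with (exp (- 1) - exp (- y));
      [|pose proof (exp_pos (- y)); lra].
    apply (is_RInt_le f (fun z => exp (- z)) 1 y); [lra| | |].
    - apply (RInt_correct (V := R_CompleteNormedModule) f), Hex. lra.
    - replace (exp (-1) - exp (- y)) with (- exp (- y) - - exp (-1)) by ring.
      apply (is_RInt_antiderivative (fun z => - exp (- z))); [lra| |];
        intros z Hz; auto_derive; auto; ring.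
    - intros z Hz. unfold f. rewrite <- (Rmult_1_l (exp (- z))) at 2.
      apply Rmult_le_compat_r; [left; apply exp_pos|].
      rewrite <- (Rpower_O z) by lra. apply Rle_Rpower; lra. }
  destruct (bounded_monotone_filterlim_at_right (fun x => RInt f x 1) 1
              (kprim0 alpha 1)) as [l1 [Hl1 Hlim1]]; [lra| | |].
  { intros x y Hxy Hy. rewrite (HCh x y 1) by lra. pose proof (Hpos x y). lra. }
  { intros x Hx. apply Rle_trans with (kprim0 alpha 1 - kprim0 alpha x).
    - apply (is_RInt_le f (fun y => Rpower y (- alpha)) x 1); [lra| | |].
      + apply (RInt_correct (V := R_CompleteNormedModule) f), Hex. lra.
      + apply (is_RInt_antiderivative (kprim0 alpha)); [lra| |]; intros y Hy.
        * apply kprim0_derive; lra.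
        * unfold Rpower. auto_derive. lra.
      + intros y Hy. unfold f. replace (1 - alpha - 1) with (- alpha) by ring.
        rewrite <- (Rmult_1_r (Rpower y (- alpha))) at 2.
        apply Rmult_le_compat_l; [left; apply exp_pos|].
        rewrite <- exp_0. left. apply exp_increasing. lra.
    - assert (0 < kprim0 alpha x); [|lra].
      unfold kprim0. apply Rdiv_lt_0_compat; [|lra].
      apply Rmult_lt_0_compat; [lra|apply exp_pos]. }
  assert (HG : is_RInt_gen f (at_right 0) (Rbar_locally p_infty) (plus l1 l2)).
  { apply (is_RInt_gen_Chasles (V := R_NormedModule)) with 1.
    - apply (is_RInt_gen_of_filterlim_l f (fun x => RInt f x 1)); [typeclasses eauto| |exact Hlim1].
      exists (mkposreal 1 Rlt_0_1). intros y Hy Hy0.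
      unfold ball in Hy; simpl in Hy; unfold AbsRing_ball, abs, minus, plus, opp in Hy;
        simpl in Hy.
      apply Rabs_def2 in Hy. apply (RInt_correct (V := R_CompleteNormedModule) f), Hex. lra.
    - apply (is_RInt_gen_of_filterlim_r f (RInt f 1)); [typeclasses eauto| |exact Hlim2].
      exists 1. intros y Hy. apply (RInt_correct (V := R_CompleteNormedModule) f), Hex. lra. }
  unfold Gamma. fold f. rewrite (is_RInt_gen_unique f (plus l1 l2) HG).
  (* Strict positivity comes from [[1/2, 1]] alone; the part beyond [1] is only known to be
     nonnegative. *)
  assert (0 < RInt f (/ 2) 1).
  { apply RInt_gt_0; [lra | auto |]. intros z Hz.
    apply (ex_derive_continuous (K := R_AbsRing) (V := R_NormedModule)).
    unfold f, Rpower. auto_derive. lra. }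
  specialize (Hl1 (/ 2) ltac:(lra)). cbv beta in Hl1.
  rewrite RInt_point in Hl2. unfold zero, plus in *; simpl in *. lra.
Qed.

(** * The interpolant *)

Lemma mesh_le (t : nat -> R) (M : nat) (T : R) (i j : nat) :
  is_mesh t M T -> (i <= j <= M)%nat -> t i <= t j.
Proof.
  intros [_ [Ht _]] [Hij HjM]. induction Hij as [|j Hij IH]; [lra|].
  specialize (Ht j ltac:(lia)). specialize (IH ltac:(lia)). lra.
Qed.

Lemma mesh_lt (t : nat -> R) (M : nat) (T : R) (i j : nat) :
  is_mesh t M T -> (i < j <= M)%nat -> t i < t j.
Proof.
  intros Hm Hij. pose proof (mesh_le t M T (S i) j Hm ltac:(lia)).
  destruct Hm as [_ [Ht _]]. specialize (Ht i ltac:(lia)). lra.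
Qed.

Lemma tau_mesh_pos (t : nat -> R) (M : nat) (T : R) (k : nat) :
  is_mesh t M T -> (1 <= k <= M)%nat -> 0 < tau_mesh t k.
Proof.
  intros Hm Hk. unfold tau_mesh.
  pose proof (mesh_lt t M T (k - 1) k Hm ltac:(lia)). lra.
Qed.

Lemma piece_eq (t : nat -> R) (M : nat) (T : R) (m k : nat) (s : R) :
  is_mesh t M T -> (1 <= k <= m)%nat -> (m <= M)%nat ->
  t (k - 1)%nat < s <= t k -> piece t m s = k.
Proof.
  intros Hm. induction m as [|m IH]; intros Hk HmM Hs; [lia|].
  destruct m as [|m]; [cbn; lia|]. cbn [piece].
  destruct (Rle_dec s (t (S m))) as [H|H].
  - destruct (Nat.eq_dec k (S (S m))) as [->|Hne].
    + replace (S (S m) - 1)%nat with (S m) in Hs by lia. lra.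
    + apply IH; [lia|lia|exact Hs].
  - destruct (Nat.eq_dec k (S (S m))) as [->|Hne]; [reflexivity|].
    pose proof (mesh_le t M T k (S m) Hm ltac:(lia)). lra.
Qed.

Definition slope (t U : nat -> R) (k : nat) : R :=
  (U k - U (k - 1)%nat) / tau_mesh t k.

Definition div_diff2 (t U : nat -> R) (k : nat) : R :=
  (slope t U (S k) - slope t U k) / (tau_mesh t k + tau_mesh t (S k)).

Definition piece_div_diff2 (t U : nat -> R) (m k : nat) : R :=
  if (m =? 1)%nat then 0 else div_diff2 t U (Nat.min k (m - 1)).

Lemma lagrange2_derive (x0 x1 x2 y0 y1 y2 s : R) :
  x0 < x1 -> x1 < x2 ->
  Derive (lagrange2 x0 x1 x2 y0 y1 y2) s =
    (y1 - y0) / (x1 - x0) + (2 * s - x0 - x1) *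
      (((y2 - y1) / (x2 - x1) - (y1 - y0) / (x1 - x0)) / ((x1 - x0) + (x2 - x1))).
Proof.
  intros H1 H2. apply is_derive_unique. unfold lagrange2. auto_derive; [auto|].
  field. lra.
Qed.

Lemma Derive_interp (t : nat -> R) (M : nat) (T : R) (U : nat -> R) (m k : nat) (s : R) :
  is_mesh t M T -> (1 <= k <= m)%nat -> (m <= M)%nat ->
  t (k - 1)%nat < s < t k ->
  Derive (Defs.interp t m U) s =
    slope t U k + (2 * s - t (k - 1)%nat - t k) * piece_div_diff2 t U m k.
Proof.
  intros Hm Hk HmM Hs.
  destruct (Nat.eq_dec m 1) as [->|Hm1].
  - replace k with 1%nat in * by lia.
    apply is_derive_unique. unfold Defs.interp, piece_div_diff2, slope, tau_mesh, lagrange1, Nat.eqb.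
    change (1 - 1)%nat with 0%nat in *.
    auto_derive; [auto|]. field. lra.
  - set (c := Nat.min k (m - 1)).
    rewrite (Derive_ext_loc _ (lagrange2 (t (c - 1)%nat) (t c) (t (c + 1)%nat)
                (U (c - 1)%nat) (U c) (U (c + 1)%nat))).
    + pose proof (mesh_lt t M T (c - 1) c Hm ltac:(lia)).
      pose proof (mesh_lt t M T c (c + 1) Hm ltac:(lia)).
      rewrite lagrange2_derive by assumption.
      unfold piece_div_diff2. destruct (Nat.eqb_spec m 1) as [?|_]; [lia|]. fold c.
      unfold div_diff2, slope, tau_mesh.
      replace (S c - 1)%nat with c by lia. replace (S c) with (c + 1)%nat by lia.
      (* For [k = m] the Newton form sits on the two left nodes of the last stencil. It is moved to
         the two right nodes by the fact that the slopes differ by the divided difference times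
         [t (c + 1) - t (c - 1)]. *)
      destruct (Nat.eq_dec k m) as [->|Hkm].
      * replace m with (c + 1)%nat by lia. replace (c + 1 - 1)%nat with c by lia.
        field. lra.
      * replace k with c by lia. reflexivity.
    + apply (locally_interval _ s (t (k - 1)%nat) (t k)); [apply Hs | apply Hs|].
      intros y Hy1 Hy2. cbn in Hy1, Hy2.
      assert (Hp : piece t m y = k) by (apply (piece_eq t M T); auto; lra).
      destruct m as [|[|m]]; [lia|lia|]. unfold Defs.interp. rewrite Hp. reflexivity.
Qed.

(** The node [w] is kept apart from the upper limit [v]: on the last interval [v] tends to [z] while
    [w] is already [z]. *)
Lemma is_RInt_kernel_affine (alpha z u v w c0 c1 : R) :
  0 < alpha < 1 -> u <= v -> v < z ->
  let F := fun x => c0 * kprim0 alpha x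
             + c1 * ((2 * z - u - w) * kprim0 alpha x - 2 * kprim1 alpha x) in
  is_RInt (fun s => Rpower (z - s) (- alpha) * (c0 + (2 * s - u - w) * c1)) u v
    (F (z - u) - F (z - v)).
Proof.
  intros Ha Huv Hv F.
  replace (F (z - u) - F (z - v)) with (- F (z - v) - - F (z - u)) by ring.
  apply (is_RInt_antiderivative (fun s => - F (z - s))); [exact Huv| |];
    intros s Hs; unfold F, kprim0, kprim1, Rpower; auto_derive; try lra;
    replace (z + - s) with (z - s) by ring; field; lra.
Qed.

(** For [x > 0] the product [x * Rpower x (- alpha)] is [exp ((1 - alpha) * ln x)], whose exponent
    tends to minus infinity. *)
Lemma kprim_filterlim_0 (alpha : R) :
  0 < alpha < 1 ->
  filterlim (kprim0 alpha) (at_right 0) (locally 0) /\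
  filterlim (kprim1 alpha) (at_right 0) (locally 0).
Proof.
  intros Ha.
  assert (H0 : filterlim (fun x => exp ((1 - alpha) * ln x)) (at_right 0) (locally 0)).
  { apply (filterlim_comp _ _ _ (fun x => (1 - alpha) * ln x) exp _
             (Rbar_locally m_infty)).
    - apply (filterlim_comp _ _ _ ln (fun y => (1 - alpha) * y) _
               (Rbar_locally m_infty)); [apply is_lim_ln_0|].
      replace m_infty with (Rbar_mult (1 - alpha) m_infty) at 2.
      + apply (filterlim_Rbar_mult_l (1 - alpha) m_infty).
      + apply is_Rbar_mult_unique. apply is_Rbar_mult_sym.
        apply is_Rbar_mult_m_infty_pos. cbn. lra.
    - apply is_lim_exp_m. }
  assert (Hid : filterlim (fun x : R => x) (at_right 0) (locally 0)).
  { intros P HP. unfold filtermap. now apply filter_le_within. }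
  assert (Hmul : forall f c, filterlim f (at_right 0) (locally 0) ->
                   filterlim (fun x => f x * c) (at_right 0) (locally 0)).
  { intros f c Hf. apply (filterlim_comp _ _ _ f (fun y => y * c) _ (locally 0));
      [exact Hf|].
    assert (Hc : continuous (fun y => y * c) 0).
    { apply (ex_derive_continuous (K := R_AbsRing) (V := R_NormedModule)).
      auto_derive. auto. }
    unfold continuous in Hc. now rewrite Rmult_0_l in Hc. }
  assert (Hexp : forall x, 0 < x -> x * Rpower x (- alpha) = exp ((1 - alpha) * ln x)).
  { intros x Hx. unfold Rpower.
    rewrite <- (exp_ln x) at 1 by exact Hx. rewrite <- exp_plus. f_equal. ring. }
  split.
  - apply (filterlim_within_ext (fun x => 0 < x) (fun x => exp ((1 - alpha) * ln x) * / (1 - alpha))).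
    + intros x Hx. unfold kprim0. now rewrite Hexp.
    + now apply Hmul.
  - apply (filterlim_within_ext (fun x => 0 < x)
             (fun x => x * exp ((1 - alpha) * ln x) * / (2 - alpha))).
    + intros x Hx. unfold kprim1. rewrite <- Hexp by exact Hx. unfold Rdiv. ring.
    + apply Hmul.
      assert (H : filterlim (fun x => x * exp ((1 - alpha) * ln x)) (at_right 0)
                    (locally (0 * 0))).
      { apply (filterlim_comp_2 (G := locally 0) (H := locally 0));
          [exact Hid | exact H0 | apply (filterlim_mult (K := R_AbsRing) 0 0)]. }
      now rewrite Rmult_0_l in H.
Qed.

Lemma filterlim_sub_at_left (z : R) :
  filterlim (fun s => z - s) (at_left z) (at_right 0).
Proof.
  intros P [d Hd]. exists d. intros s Hs Hsz. apply Hd; [|lra].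
  unfold ball in *; simpl in *; unfold AbsRing_ball, abs, minus, plus, opp in *;
    simpl in *.
  rewrite <- Rabs_Ropp. replace (- (z - s + - 0)) with (s + - z) by ring. exact Hs.
Qed.

Lemma kprim_affine_filterlim (alpha z c d : R) :
  0 < alpha < 1 ->
  filterlim (fun s => c * kprim0 alpha (z - s) + d * kprim1 alpha (z - s))
    (at_left z) (locally 0).
Proof.
  intros Ha. destruct (kprim_filterlim_0 alpha Ha) as [H0 H1].
  assert (H : filterlim (fun x => c * kprim0 alpha x + d * kprim1 alpha x)
                (at_right 0) (locally (c * 0 + d * 0))).
  { apply (filterlim_comp_2 (G := locally (c * 0)) (H := locally (d * 0))).
    - apply (filterlim_comp _ _ _ (kprim0 alpha) (fun y => c * y) _ (locally 0));
        [exact H0 | apply (filterlim_scal_r (K := R_AbsRing) (V := R_NormedModule) c 0)].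
    - apply (filterlim_comp _ _ _ (kprim1 alpha) (fun y => d * y) _ (locally 0));
        [exact H1 | apply (filterlim_scal_r (K := R_AbsRing) (V := R_NormedModule) d 0)].
    - apply (filterlim_plus (K := R_AbsRing) (V := R_NormedModule)). }
  replace (c * 0 + d * 0) with 0 in H by ring.
  apply (filterlim_comp _ _ _ (fun s => z - s)
           (fun x => c * kprim0 alpha x + d * kprim1 alpha x) _ (at_right 0));
    [apply filterlim_sub_at_left | exact H].
Qed.

(** * The discrete operator as a weighted sum of increments *)

Definition mesh_int0 (alpha : R) (t : nat -> R) (m k : nat) : R :=
  kint0 alpha (t m - t k) (t m - t (k - 1)%nat).
Definition mesh_int1 (alpha : R) (t : nat -> R) (m k : nat) : R :=
  kint1 alpha (t m - t k) (t m - t (k - 1)%nat).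

(* The terms [k = 0] vanish since [0 - 1 = 0] in [nat]. *)
Lemma mesh_int_0 (alpha : R) (t : nat -> R) (m : nat) :
  mesh_int0 alpha t m 0 = 0 /\ mesh_int1 alpha t m 0 = 0.
Proof.
  unfold mesh_int0, mesh_int1, kint1, kint0. cbn [Nat.sub]. split; ring.
Qed.

Definition mesh_sum (alpha : R) (t U : nat -> R) (m n : nat) : R :=
  sum_f_R0 (fun k => slope t U k * mesh_int0 alpha t m k
                     + piece_div_diff2 t U m k * mesh_int1 alpha t m k) n.

Lemma is_RInt_interp_head (alpha : R) (t : nat -> R) (M : nat) (T : R)
    (U : nat -> R) (m n : nat) :
  0 < alpha < 1 -> is_mesh t M T -> (n < m <= M)%nat ->
  is_RInt (fun s => Rpower (t m - s) (- alpha) * Derive (Defs.interp t m U) s)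
    0 (t n) (mesh_sum alpha t U m n).
Proof.
  intros Ha Hm Hn. induction n as [|n IH].
  - destruct Hm as [-> _]. unfold mesh_sum. cbn [sum_f_R0].
    destruct (mesh_int_0 alpha t m) as [-> ->].
    rewrite !Rmult_0_r, Rplus_0_r. apply (is_RInt_point (V := R_NormedModule)).
  - unfold mesh_sum. cbn [sum_f_R0].
    apply (is_RInt_Chasles (V := R_NormedModule)) with (t n); [apply IH; lia|].
    pose proof (mesh_lt t M T n (S n) Hm ltac:(lia)).
    pose proof (mesh_lt t M T (S n) m Hm ltac:(lia)).
    apply (is_RInt_ext (fun s => Rpower (t m - s) (- alpha) *
             (slope t U (S n)
              + (2 * s - t n - t (S n)) * piece_div_diff2 t U m (S n)))).
    + rewrite Rmin_left, Rmax_right by lra. intros s Hs.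
      rewrite (Derive_interp t M T U m (S n)); auto; try lia;
        replace (S n - 1)%nat with n by lia; auto.
    + pose proof (is_RInt_kernel_affine alpha (t m) (t n) (t (S n)) (t (S n))
        (slope t U (S n)) (piece_div_diff2 t U m (S n)) Ha ltac:(lra) ltac:(lra)) as HI.
      cbv zeta beta in HI.
      refine (eq_ind _ (fun l : R => is_RInt (V := R_NormedModule) _ _ _ l) HI _ _).
      unfold mesh_int0, mesh_int1, kint1, kint0.
      replace (S n - 1)%nat with n by lia. ring.
Qed.

Lemma is_RInt_gen_interp_last (alpha : R) (t : nat -> R) (M : nat) (T : R)
    (U : nat -> R) (m : nat) :
  0 < alpha < 1 -> is_mesh t M T -> (S m <= M)%nat ->
  is_RInt_gen
    (fun s => Rpower (t (S m) - s) (- alpha) * Derive (Defs.interp t (S m) U) s)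
    (at_point (t m)) (at_left (t (S m)))
    (slope t U (S m) * mesh_int0 alpha t (S m) (S m)
     + piece_div_diff2 t U (S m) (S m) * mesh_int1 alpha t (S m) (S m)).
Proof.
  intros Ha Hm Hn.
  pose proof (mesh_lt t M T m (S m) Hm ltac:(lia)) as Hlt.
  set (z := t (S m)) in *. set (u := t m) in *.
  set (c0 := slope t U (S m)). set (c1 := piece_div_diff2 t U (S m) (S m)).
  set (F := fun x => c0 * kprim0 alpha x
         + c1 * ((2 * z - u - z) * kprim0 alpha x - 2 * kprim1 alpha x)).
  replace (c0 * mesh_int0 alpha t (S m) (S m) + c1 * mesh_int1 alpha t (S m) (S m))
    with (F (z - u)).
  (* The terms at [z - z = 0] drop out through their factors [x] and [x ^ 2]. *)
  2:{ unfold F, mesh_int0, mesh_int1, kint1, kint0, kprim0, kprim1.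
      replace (S m - 1)%nat with m by lia. fold z u.
      replace (z - z) with 0 by ring. unfold Rdiv. ring. }
  apply (is_RInt_gen_of_filterlim_r _ (fun v => F (z - u) - F (z - v)));
    [typeclasses eauto | |].
  - exists (mkposreal (z - u) ltac:(lra)). intros v Hv Hvz.
    unfold ball in Hv; simpl in Hv; unfold AbsRing_ball, abs, minus, plus, opp in Hv;
      simpl in Hv.
    apply Rabs_def2 in Hv.
    apply (is_RInt_ext (fun s => Rpower (z - s) (- alpha) *
             (c0 + (2 * s - u - z) * c1))).
    + rewrite Rmin_left, Rmax_right by lra. intros s Hs.
      rewrite (Derive_interp t M T U (S m) (S m)); auto; try lia;
        replace (S m - 1)%nat with m by lia; fold z u; auto; lra.
    + apply is_RInt_kernel_affine; lra.
  - pose proof (kprim_affine_filterlim alpha z (c0 + c1 * (2 * z - u - z)) (- (2 * c1)) Ha)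
      as Hlim.
    assert (H : filterlim (fun v => F (z - u) - F (z - v)) (at_left z)
                  (locally (F (z - u) - 0))).
    { apply (filterlim_comp_2 (G := locally (F (z - u))) (H := locally (- 0))
               (fun _ => F (z - u)) (fun v => - F (z - v)) Rplus).
      - apply filterlim_const.
      - apply (filterlim_comp _ _ _ (fun v => F (z - v)) Ropp _ (locally 0)).
        + revert Hlim. apply filterlim_ext. intros v. unfold F. ring.
        + apply (filterlim_opp (K := R_AbsRing) (V := R_NormedModule) 0).
      - apply (filterlim_plus (K := R_AbsRing) (V := R_NormedModule)). }
    now rewrite Rminus_0_r in H.
Qed.

Lemma delta_eq_mesh_sum (alpha : R) (t : nat -> R) (M : nat) (T : R)
    (U : nat -> R) (m : nat) :
  0 < alpha < 1 -> is_mesh t M T -> (1 <= m <= M)%nat ->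
  delta alpha t m U = / Gamma (1 - alpha) * mesh_sum alpha t U m m.
Proof.
  intros Ha Hm Hmm. unfold delta, caputo. f_equal.
  destruct m as [|m]; [lia|].
  apply is_RInt_gen_unique.
  unfold mesh_sum. cbn [sum_f_R0].
  apply (is_RInt_gen_Chasles (V := R_NormedModule)) with (t m).
  - apply is_RInt_gen_at_point. apply (is_RInt_interp_head alpha t M T); auto. lia.
  - apply (is_RInt_gen_interp_last alpha t M T); auto. lia.
Qed.

(** What the slope jump [slope (S k) - slope k] is multiplied by in the integral over the [k]-th
    interval, for [k < m]. *)
Definition mesh_curv (alpha : R) (t : nat -> R) (m k : nat) : R :=
  mesh_int1 alpha t m k / (tau_mesh t k + tau_mesh t (S k)).

(** Its analogue on the last interval, where the jump is the one at [t_(m-1)]; for [m = 1] the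
    interpolant is linear and has no such term. *)
Definition last_curv (alpha : R) (t : nat -> R) (m : nat) : R :=
  if (m =? 1)%nat then 0
  else mesh_int1 alpha t m m / (tau_mesh t (m - 1) + tau_mesh t m).

(* The difference [U^k - U^(k-1)] enters through its slope on the [k]-th interval
   and through the divided differences of the two neighbouring stencils; the
   stencil centred at [t_(m-1)] is used twice, on the last two intervals. *)
Definition weight (alpha : R) (t : nat -> R) (m k : nat) : R :=
  if (k =? 0)%nat then 0 else
  (mesh_int0 alpha t m k + mesh_curv alpha t m (k - 1)
   + (if (k =? m)%nat then last_curv alpha t m
      else if (S k =? m)%nat then - mesh_curv alpha t m k - last_curv alpha t m
      else - mesh_curv alpha t m k)) / tau_mesh t k.

(** Abel summation. As [n < m], each interval uses the stencil centred at its right end, and the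
    jump at [t_n] leaves one boundary term with the next slope. *)
Lemma mesh_sum_by_parts (alpha : R) (t : nat -> R) (M : nat) (T : R)
    (U : nat -> R) (m n : nat) :
  is_mesh t M T -> (n < m <= M)%nat ->
  mesh_sum alpha t U m n =
  sum_f_R0 (fun k => (mesh_int0 alpha t m k + mesh_curv alpha t m (k - 1)
                      - mesh_curv alpha t m k) * slope t U k) n
  + mesh_curv alpha t m n * slope t U (S n).
Proof.
  intros Hm Hn. unfold mesh_sum. induction n as [|n IH].
  - cbn [sum_f_R0 Nat.sub]. unfold mesh_curv.
    destruct (mesh_int_0 alpha t m) as [-> ->]. unfold Rdiv. ring.
  - cbn [sum_f_R0]. rewrite IH by lia.
    replace (S n - 1)%nat with n by lia.
    replace (piece_div_diff2 t U m (S n) * mesh_int1 alpha t m (S n))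
      with (mesh_curv alpha t m (S n) * (slope t U (S (S n)) - slope t U (S n)));
      [ring|].
    replace (piece_div_diff2 t U m (S n)) with (div_diff2 t U (S n)).
    + unfold mesh_curv, div_diff2.
      pose proof (tau_mesh_pos t M T (S n) Hm ltac:(lia)).
      pose proof (tau_mesh_pos t M T (S (S n)) Hm ltac:(lia)).
      field. lra.
    + unfold piece_div_diff2. destruct (Nat.eqb_spec m 1); [lia|].
      f_equal. lia.
Qed.

Lemma mesh_sum_eq_weight (alpha : R) (t : nat -> R) (M : nat) (T : R)
    (U : nat -> R) (m : nat) :
  is_mesh t M T -> (1 <= m <= M)%nat ->
  mesh_sum alpha t U m m =
  sum_f_R0 (fun k => weight alpha t m k * (U k - U (k - 1)%nat)) m.
Proof.
  intros Hm Hmm. destruct m as [|m]; [lia|].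
  assert (Hw : forall k c, (1 <= k)%nat ->
    c / tau_mesh t k * (U k - U (k - 1)%nat) = c * slope t U k)
    by (intros; unfold slope, Rdiv; ring).
  destruct m as [|m].
  - unfold mesh_sum, weight, last_curv, piece_div_diff2. cbn [sum_f_R0 Nat.eqb].
    rewrite Hw by lia. unfold mesh_curv. change (1 - 1)%nat with 0%nat.
    destruct (mesh_int_0 alpha t 1) as [-> ->]. unfold Rdiv. ring.
  - change (mesh_sum alpha t U (S (S m)) (S (S m))) with
      (mesh_sum alpha t U (S (S m)) (S m) +
       (slope t U (S (S m)) * mesh_int0 alpha t (S (S m)) (S (S m))
        + piece_div_diff2 t U (S (S m)) (S (S m))
            * mesh_int1 alpha t (S (S m)) (S (S m)))).
    rewrite (mesh_sum_by_parts alpha t M T) by (auto; lia).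
    cbn [sum_f_R0].
    rewrite (sum_eq (fun k => weight _ _ _ k * _)
      (fun k => (mesh_int0 alpha t (S (S m)) k + mesh_curv alpha t (S (S m)) (k - 1)
                 - mesh_curv alpha t (S (S m)) k) * slope t U k)).
    + unfold weight.
      rewrite Nat.eqb_refl.
      destruct (Nat.eqb_spec (S (S m)) 0); [lia|].
      destruct (Nat.eqb_spec (S m) 0); [lia|].
      destruct (Nat.eqb_spec (S m) (S (S m))); [lia|].
      rewrite !Hw by lia.
      replace (piece_div_diff2 t U (S (S m)) (S (S m))
               * mesh_int1 alpha t (S (S m)) (S (S m)))
        with (last_curv alpha t (S (S m)) * (slope t U (S (S m)) - slope t U (S m))).
      * replace (S (S m) - 1)%nat with (S m) by lia. ring.
      * unfold last_curv, piece_div_diff2.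
        destruct (Nat.eqb_spec (S (S m)) 1); [lia|].
        replace (Nat.min (S (S m)) (S (S m) - 1)) with (S m) by lia.
        replace (S (S m) - 1)%nat with (S m) by lia.
        unfold div_diff2.
        pose proof (tau_mesh_pos t M T (S m) Hm ltac:(lia)).
        pose proof (tau_mesh_pos t M T (S (S m)) Hm ltac:(lia)).
        field. lra.
    + intros k Hk. unfold weight. destruct (Nat.eqb_spec k 0) as [->|H0].
      * cbn [Nat.sub]. unfold mesh_curv, slope.
        destruct (mesh_int_0 alpha t (S (S m))) as [-> ->]. cbn [Nat.sub].
        unfold Rdiv. ring.
      * destruct (Nat.eqb_spec k (S (S m))); [lia|].
        destruct (Nat.eqb_spec (S k) (S (S m))); [lia|].
        rewrite Hw by lia. ring.
Qed.

(** * Bounds on the weights *)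

Lemma sigma_mesh_bounds (t : nat -> R) (M : nat) (T : R) (k : nat) :
  is_mesh t M T -> mesh_condition t M -> (2 <= k <= M)%nat ->
  0 <= sigma_mesh t k < 1.
Proof.
  intros Hm [_ Hs] Hk. split; [now apply Hs|].
  pose proof (tau_mesh_pos t M T k Hm ltac:(lia)).
  pose proof (tau_mesh_pos t M T (k - 1) Hm ltac:(lia)).
  unfold sigma_mesh. apply Rmult_lt_reg_r with (tau_mesh t k + tau_mesh t (k - 1));
    [lra|].
  unfold Rdiv. rewrite Rmult_assoc, Rinv_l by lra. lra.
Qed.

Lemma ratio_of_sigma_mesh (t : nat -> R) (M : nat) (T : R) (k : nat) :
  is_mesh t M T -> (1 <= k)%nat -> (S k <= M)%nat ->
  ratio_of_sigma (sigma_mesh t (S k)) = tau_mesh t k / tau_mesh t (S k).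
Proof.
  intros Hm Hk HkM.
  pose proof (tau_mesh_pos t M T k Hm ltac:(lia)).
  pose proof (tau_mesh_pos t M T (S k) Hm ltac:(lia)).
  unfold ratio_of_sigma, sigma_mesh. replace (S k - 1)%nat with k by lia.
  field. lra.
Qed.

Lemma tau_mesh_of_sigma (t : nat -> R) (M : nat) (T : R) (k : nat) (s : R) :
  is_mesh t M T -> (1 <= k)%nat -> (S k <= M)%nat ->
  0 <= sigma_mesh t (S k) <= s ->
  tau_mesh t k <= tau_mesh t (S k) /\
  (1 - s) * tau_mesh t (S k) <= (1 + s) * tau_mesh t k.
Proof.
  intros Hm Hk HkM Hs.
  pose proof (tau_mesh_pos t M T k Hm ltac:(lia)).
  pose proof (tau_mesh_pos t M T (S k) Hm ltac:(lia)).
  assert (E : sigma_mesh t (S k) * (tau_mesh t (S k) + tau_mesh t k) =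
              tau_mesh t (S k) - tau_mesh t k).
  { unfold sigma_mesh. replace (S k - 1)%nat with k by lia. field. lra. }
  split; nra.
Qed.

Lemma beta_eq (alpha theta : R) (t : nat -> R) (j : nat) :
  (1 <= j)%nat ->
  beta alpha theta t j = beta_of_sigma alpha theta (sigma_mesh t (Nat.max 2 j)).
Proof. intros Hj. destruct j as [|[|j]]; [lia|reflexivity|reflexivity]. Qed.

Lemma beta_decreasing (alpha theta : R) (t : nat -> R) (M : nat) (T : R) (j : nat) :
  0 < alpha < 1 -> / 2 <= theta <= 1 -> is_mesh t M T -> mesh_condition t M ->
  (1 <= j)%nat -> (j < M)%nat ->
  beta alpha theta t (S j) <= beta alpha theta t j /\ 0 < beta alpha theta t (S j).
Proof.
  intros Ha Ht Hm Hc Hj HjM. rewrite !beta_eq by lia.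
  pose proof (sigma_mesh_bounds t M T (S j) Hm Hc ltac:(lia)).
  replace (Nat.max 2 (S j)) with (S j) by lia.
  split; [|now apply beta_of_sigma_pos].
  destruct (Nat.eq_dec j 1) as [->|Hj1]; [apply Rle_refl|].
  replace (Nat.max 2 j) with j by lia.
  pose proof (sigma_mesh_bounds t M T j Hm Hc ltac:(lia)).
  apply beta_of_sigma_increasing; try tauto.
  apply (proj1 Hc); lia.
Qed.

(** Minus the derivative of [x^(-alpha)]. *)
Definition kslope (alpha x : R) : R := alpha * Rpower x (- alpha) / x.

Lemma kslope_double (alpha x y : R) :
  0 < alpha < 1 -> 0 < x -> x <= y <= 2 * x -> kslope alpha x <= 4 * kslope alpha y.
Proof.
  intros Ha Hx Hy.
  apply Rle_trans with (4 * kslope alpha (2 * x)).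
  - unfold kslope. rewrite <- Rpower_mult_distr by lra.
    assert (H2 : / 2 <= Rpower 2 (- alpha)).
    { rewrite <- (Rpower_1 2) at 1 by lra. rewrite <- Rpower_Ropp.
      apply Rle_Rpower; lra. }
    replace (4 * (alpha * (Rpower 2 (- alpha) * Rpower x (- alpha)) / (2 * x)))
      with (alpha * Rpower x (- alpha) / x * (2 * Rpower 2 (- alpha)))
      by (field; lra).
    rewrite <- (Rmult_1_r (alpha * Rpower x (- alpha) / x)) at 1.
    apply Rmult_le_compat_l; [|lra].
    left. apply Rdiv_lt_0_compat; [|lra].
    apply Rmult_lt_0_compat; [lra|apply exp_pos].
  - apply Rmult_le_compat_l; [lra|]. apply Rpower_opp_slope_decreasing; lra.
Qed.

Lemma kslope_pos (alpha x : R) : 0 < alpha -> 0 < x -> 0 < kslope alpha x.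
Proof.
  intros Ha Hx. unfold kslope. apply Rdiv_lt_0_compat; [|lra].
  apply Rmult_lt_0_compat; [lra|apply exp_pos].
Qed.

Lemma mesh_int_bounds (alpha : R) (t : nat -> R) (M : nat) (T : R) (m k : nat) :
  0 < alpha < 1 -> is_mesh t M T -> (1 <= k < m)%nat -> (m <= M)%nat ->
  tau_mesh t k * Rpower (t m - t (k - 1)%nat) (- alpha) <= mesh_int0 alpha t m k /\
  mesh_int0 alpha t m k <= tau_mesh t k * Rpower (t m - t k) (- alpha)
    - tau_mesh t k ^ 2 * kslope alpha (t m - t (k - 1)%nat) / 2 /\
  0 <= mesh_int1 alpha t m k <= tau_mesh t k * mesh_int0 alpha t m k /\
  mesh_int1 alpha t m k <= kslope alpha (t m - t k) * tau_mesh t k ^ 3 / 6.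
Proof.
  intros Ha Hm Hk HmM.
  pose proof (mesh_lt t M T (k - 1) k Hm ltac:(lia)).
  pose proof (mesh_lt t M T k m Hm ltac:(lia)).
  unfold mesh_int0, mesh_int1.
  set (x := t m - t k). set (X := t m - t (k - 1)%nat).
  assert (Hx : 0 < x < X) by (unfold x, X; lra).
  replace (tau_mesh t k) with (X - x) by (unfold x, X, tau_mesh; ring).
  assert (Ha' : 0 <= alpha < 1) by lra.
  repeat split.
  - now apply kint0_ge.
  - eapply Rle_trans; [now apply kint0_le_trapezoid|].
    (* The tangent at the far end [X] lowers the second trapezoid value to
       [x^(-alpha) - kslope X * (X - x)]; averaging leaves half of that gain. *)
    pose proof (Rpower_opp_tangent alpha X x ltac:(lra) ltac:(lra) ltac:(lra)) as Ht.
    fold (kslope alpha X) in Ht. nra.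
  - now apply kint1_ge0.
  - now apply kint1_le_kint0.
  - now apply kint1_le.
Qed.

Lemma mesh_curv_0 (alpha : R) (t : nat -> R) (m : nat) : mesh_curv alpha t m 0 = 0.
Proof.
  unfold mesh_curv. destruct (mesh_int_0 alpha t m) as [_ ->]. unfold Rdiv. ring.
Qed.

(** The cubic bound of [kint1_le], divided by [tau_k + tau_(k+1) >= 2 tau_k], yields the factor
    [1/12]. *)
Lemma mesh_curv_bounds (alpha : R) (t : nat -> R) (M : nat) (T : R) (m k : nat) :
  0 < alpha < 1 -> is_mesh t M T -> (k < m)%nat -> (m <= M)%nat ->
  ((1 <= k)%nat -> tau_mesh t k <= tau_mesh t (S k)) ->
  0 <= mesh_curv alpha t m k <= kslope alpha (t m - t k) * tau_mesh t k ^ 2 / 12.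
Proof.
  intros Ha Hm Hk HmM Ht.
  pose proof (mesh_lt t M T k m Hm ltac:(lia)) as Hx.
  pose proof (kslope_pos alpha (t m - t k) ltac:(lra) ltac:(lra)) as HL.
  destruct (Nat.eq_dec k 0) as [->|Hk0].
  - rewrite mesh_curv_0. pose proof (pow2_ge_0 (tau_mesh t 0)). nra.
  - specialize (Ht ltac:(lia)).
    pose proof (tau_mesh_pos t M T k Hm ltac:(lia)) as Hp.
    destruct (mesh_int_bounds alpha t M T m k Ha Hm ltac:(lia) HmM)
      as [_ [_ [[H1 _] H2]]].
    set (L := kslope alpha (t m - t k)) in *. set (a := tau_mesh t k) in *.
    unfold mesh_curv. fold a. set (b := tau_mesh t (S k)) in *.
    split.
    + apply Rmult_le_pos; [exact H1|]. left. apply Rinv_0_lt_compat. lra.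
    + apply Rmult_le_reg_r with (a + b); [lra|].
      unfold Rdiv at 1. rewrite Rmult_assoc, Rinv_l, Rmult_1_r by lra.
      apply (Rle_trans _ _ _ H2).
      assert (0 < L * a ^ 2) by (apply Rmult_lt_0_compat; [lra|nra]).
      replace (L * a ^ 3 / 6) with (L * a ^ 2 * (a / 6)) by field.
      replace (L * a ^ 2 / 12 * (a + b)) with (L * a ^ 2 * ((a + b) / 12)) by field.
      apply Rmult_le_compat_l; lra.
Qed.

Lemma weight_inner_eq (alpha : R) (t : nat -> R) (m k : nat) :
  (1 <= k)%nat -> (S k < m)%nat ->
  weight alpha t m k =
  (mesh_int0 alpha t m k + mesh_curv alpha t m (k - 1) - mesh_curv alpha t m k)
    / tau_mesh t k.
Proof.
  intros Hk Hm. unfold weight.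
  destruct (Nat.eqb_spec k 0); [lia|].
  destruct (Nat.eqb_spec k m); [lia|].
  destruct (Nat.eqb_spec (S k) m); [lia|]. reflexivity.
Qed.

Lemma weight_last_eq (alpha : R) (t : nat -> R) (M : nat) (T : R) (n : nat) :
  0 < alpha < 1 -> is_mesh t M T -> (S (S n) <= M)%nat ->
  weight alpha t (S (S n)) (S (S n)) =
  Rpower (t (S (S n)) - t n) (- alpha) / ((1 - alpha) * (2 - alpha)) *
    (2 + alpha * (tau_mesh t (S n) / tau_mesh t (S (S n)))).
Proof.
  intros Ha Hm Hn.
  pose proof (tau_mesh_pos t M T (S n) Hm ltac:(lia)) as H1.
  pose proof (tau_mesh_pos t M T (S (S n)) Hm ltac:(lia)) as H2.
  assert (E : t (S (S n)) - t n = tau_mesh t (S (S n)) + tau_mesh t (S n)).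
  { unfold tau_mesh. rewrite !Nat.sub_1_r. cbn [Nat.pred]. ring. }
  rewrite E, <- last_weight_eq by assumption. unfold weight.
  rewrite Nat.eqb_refl. cbn [Nat.eqb]. unfold last_curv. cbn [Nat.eqb].
  unfold mesh_curv, mesh_int0, mesh_int1. rewrite !Nat.sub_1_r. cbn [Nat.pred].
  rewrite E. replace (t (S (S n)) - t (S (S n))) with 0 by ring.
  replace (t (S (S n)) - t (S n)) with (tau_mesh t (S (S n)))
    by (unfold tau_mesh; rewrite Nat.sub_1_r; reflexivity).
  field. lra.
Qed.

Lemma weight_penultimate_eq (alpha : R) (t : nat -> R) (M : nat) (T : R) (n : nat) :
  0 < alpha < 1 -> is_mesh t M T -> (S (S n) <= M)%nat ->
  weight alpha t (S (S n)) (S n) =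
  Rpower (t (S (S n)) - t n) (- alpha) / ((1 - alpha) * (2 - alpha)) *
    (2 - 2 * alpha - alpha / (tau_mesh t (S n) / tau_mesh t (S (S n))))
  + mesh_curv alpha t (S (S n)) n / tau_mesh t (S n).
Proof.
  intros Ha Hm Hn.
  pose proof (tau_mesh_pos t M T (S n) Hm ltac:(lia)) as H1.
  pose proof (tau_mesh_pos t M T (S (S n)) Hm ltac:(lia)) as H2.
  assert (E : t (S (S n)) - t n = tau_mesh t (S (S n)) + tau_mesh t (S n)).
  { unfold tau_mesh. rewrite !Nat.sub_1_r. cbn [Nat.pred]. ring. }
  rewrite E, <- penultimate_weight_eq by assumption. unfold weight.
  destruct (Nat.eqb_spec (S n) 0); [lia|].
  destruct (Nat.eqb_spec (S n) (S (S n))); [lia|].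
  rewrite Nat.eqb_refl. unfold last_curv. cbn [Nat.eqb].
  rewrite !Nat.sub_1_r. cbn [Nat.pred]. set (c := mesh_curv alpha t (S (S n)) n).
  unfold mesh_curv, mesh_int0, mesh_int1. rewrite !Nat.sub_1_r. cbn [Nat.pred].
  rewrite E. replace (t (S (S n)) - t (S (S n))) with 0 by ring.
  replace (t (S (S n)) - t (S n)) with (tau_mesh t (S (S n)))
    by (unfold tau_mesh; rewrite Nat.sub_1_r; reflexivity).
  field. lra.
Qed.

Lemma weight_1_pos (alpha : R) (t : nat -> R) (M : nat) (T : R) :
  0 < alpha < 1 -> is_mesh t M T -> (1 <= M)%nat -> 0 < weight alpha t 1 1.
Proof.
  intros Ha Hm HM.
  pose proof (tau_mesh_pos t M T 1 Hm ltac:(lia)) as H1.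
  unfold weight, last_curv. cbn [Nat.eqb]. change (1 - 1)%nat with 0%nat.
  rewrite mesh_curv_0. apply Rdiv_lt_0_compat; [|exact H1].
  unfold mesh_int0, kint0. replace (t 1%nat - t 1%nat) with 0 by ring.
  change (t 1%nat - t (1 - 1)%nat) with (tau_mesh t 1).
  assert (0 < kprim0 alpha (tau_mesh t 1)).
  { unfold kprim0. apply Rdiv_lt_0_compat; [|lra].
    apply Rmult_lt_0_compat; [exact H1|apply exp_pos]. }
  replace (kprim0 alpha 0) with 0 by (unfold kprim0, Rdiv; ring). lra.
Qed.

Definition nearly_uniform (t : nat -> R) (M : nat) : Prop :=
  forall k, (1 <= k)%nat -> (S k <= M)%nat ->
    tau_mesh t k <= tau_mesh t (S k) /\ 4 * tau_mesh t (S k) <= 5 * tau_mesh t k.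

(** Needed for [k = m - 2]. The gain [tau_k^2 L / 2] from convexity absorbs the [tau_(k-1)^2 L / 12]
    of the neighbouring stencil. *)
Lemma weight_le_kernel (alpha : R) (t : nat -> R) (M : nat) (T : R) (m k : nat) :
  0 < alpha < 1 -> is_mesh t M T -> nearly_uniform t M ->
  (S k < m)%nat -> (m <= M)%nat ->
  weight alpha t m k <= Rpower (t m - t k) (- alpha).
Proof.
  intros Ha Hm Hu Hk HmM.
  destruct (Nat.eq_dec k 0) as [->|Hk0].
  { unfold weight. cbn [Nat.eqb]. left. apply exp_pos. }
  rewrite weight_inner_eq by lia.
  pose proof (tau_mesh_pos t M T k Hm ltac:(lia)) as Hp.
  destruct (mesh_int_bounds alpha t M T m k Ha Hm ltac:(lia) HmM) as [_ [H1 _]].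
  pose proof (mesh_curv_bounds alpha t M T m k Ha Hm ltac:(lia) HmM
                (fun _ => proj1 (Hu k ltac:(lia) ltac:(lia)))) as [H2 _].
  assert (Hk' : (1 <= k - 1)%nat -> tau_mesh t (k - 1) <= tau_mesh t (S (k - 1)))
    by (intros; apply Hu; lia).
  pose proof (mesh_curv_bounds alpha t M T m (k - 1) Ha Hm ltac:(lia) HmM Hk') as [_ H3].
  assert (H4 : 0 <= tau_mesh t (k - 1) <= tau_mesh t k).
  { destruct (Nat.eq_dec k 1) as [->|Hk1].
    - change (tau_mesh t (1 - 1)) with (t 0%nat - t 0%nat). lra.
    - replace (S (k - 1)) with k in Hk' by lia. specialize (Hk' ltac:(lia)).
      pose proof (tau_mesh_pos t M T (k - 1) Hm ltac:(lia)). lra. }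
  pose proof (mesh_lt t M T (k - 1) m Hm ltac:(lia)).
  pose proof (kslope_pos alpha (t m - t (k - 1)%nat) ltac:(lra) ltac:(lra)) as HL.
  set (L := kslope alpha (t m - t (k - 1)%nat)) in *.
  assert (L * tau_mesh t (k - 1) ^ 2 <= L * tau_mesh t k ^ 2).
  { apply Rmult_le_compat_l; [lra|]. apply pow_incr. lra. }
  assert (0 <= L * tau_mesh t k ^ 2) by (apply Rmult_le_pos; [lra|apply pow2_ge_0]).
  apply Rmult_le_reg_r with (tau_mesh t k); [lra|].
  unfold Rdiv. rewrite Rmult_assoc, Rinv_l, Rmult_1_r by lra. lra.
Qed.

Lemma weight_increasing (alpha : R) (t : nat -> R) (M : nat) (T : R) (m j : nat) :
  0 < alpha < 1 -> is_mesh t M T -> nearly_uniform t M ->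
  (j + 3 <= m)%nat -> (m <= M)%nat ->
  weight alpha t m j <= weight alpha t m (S j).
Proof.
  intros Ha Hm Hu Hj HmM.
  rewrite (weight_inner_eq alpha t m (S j)) by lia.
  replace (S j - 1)%nat with j by lia.
  pose proof (tau_mesh_pos t M T (S j) Hm ltac:(lia)) as Hp1.
  pose proof (tau_mesh_pos t M T (S (S j)) Hm ltac:(lia)) as Hp2.
  destruct (Hu (S j) ltac:(lia) ltac:(lia)) as [Hu1 _].
  destruct (mesh_int_bounds alpha t M T m (S j) Ha Hm ltac:(lia) HmM)
    as [I1 [_ [I2 _]]].
  replace (S j - 1)%nat with j in I1 by lia.
  destruct (Nat.eq_dec j 0) as [->|Hj0].
  (* Since [g_0 = 0], this case asks that [g_1 >= 0], which follows from
     [mesh_int1 <= tau_1 * mesh_int0]. *)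
  - unfold weight. cbn [Nat.eqb]. rewrite mesh_curv_0.
    apply Rmult_le_pos; [|left; now apply Rinv_0_lt_compat].
    assert (mesh_curv alpha t m 1 <= mesh_int0 alpha t m 1); [|lra].
    unfold mesh_curv.
    apply Rmult_le_reg_r with (tau_mesh t 1 + tau_mesh t 2); [lra|].
    unfold Rdiv. rewrite Rmult_assoc, Rinv_l, Rmult_1_r by lra.
    assert (0 <= mesh_int0 alpha t m 1).
    { apply (Rle_trans _ _ _ (Rmult_le_pos _ _ (Rlt_le _ _ Hp1) (Rlt_le _ _ (exp_pos _))) I1). }
    nra.
  - rewrite weight_inner_eq by lia.
    pose proof (tau_mesh_pos t M T j Hm ltac:(lia)) as Hp0.
    destruct (Hu j ltac:(lia) ltac:(lia)) as [Hu0 Hr].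
    destruct (mesh_int_bounds alpha t M T m j Ha Hm ltac:(lia) HmM) as [_ [I0 _]].
    pose proof (mesh_curv_bounds alpha t M T m (S j) Ha Hm ltac:(lia) HmM
                  (fun _ => Hu1)) as [_ C2].
    pose proof (mesh_curv_bounds alpha t M T m j Ha Hm ltac:(lia) HmM
                  (fun _ => Hu0)) as [C1 _].
    assert (Hj' : (1 <= j - 1)%nat -> tau_mesh t (j - 1) <= tau_mesh t (S (j - 1)))
      by (intros; apply Hu; lia).
    pose proof (mesh_curv_bounds alpha t M T m (j - 1) Ha Hm ltac:(lia) HmM Hj')
      as [_ C0].
    assert (H4 : 0 <= tau_mesh t (j - 1) <= tau_mesh t j).
    { destruct (Nat.eq_dec j 1) as [->|Hj1].
      - change (tau_mesh t (1 - 1)) with (t 0%nat - t 0%nat). lra.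
      - replace (S (j - 1)) with j in Hj' by lia. specialize (Hj' ltac:(lia)).
        pose proof (tau_mesh_pos t M T (j - 1) Hm ltac:(lia)). lra. }
    pose proof (mesh_lt t M T (j - 1) m Hm ltac:(lia)).
    pose proof (mesh_lt t M T (S j) m Hm ltac:(lia)).
    pose proof (kslope_pos alpha (t m - t (j - 1)%nat) ltac:(lra) ltac:(lra)) as HL.
    (* By [j + 3 <= m], two more steps follow [t_(j+1)], together at least as long as the two before
       it, so going back to [t_(j-1)] at most doubles the distance to [t_m]. *)
    assert (HD : kslope alpha (t m - t (S j)) <= 4 * kslope alpha (t m - t (j - 1)%nat)).
    { apply kslope_double; [exact Ha | lra |].
      destruct (Hu (S (S j)) ltac:(lia) ltac:(lia)) as [Hu2 _].
      pose proof (mesh_le t M T (S (S (S j))) m Hm ltac:(lia)).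
      unfold tau_mesh in *. replace (S j - 1)%nat with j in * by lia.
      replace (S (S j) - 1)%nat with (S j) in * by lia.
      replace (S (S (S j)) - 1)%nat with (S (S j)) in * by lia. lra. }
    set (L := kslope alpha (t m - t (j - 1)%nat)) in *.
    set (K := Rpower (t m - t j) (- alpha)) in *.
    set (a := tau_mesh t j) in *. set (b := tau_mesh t (S j)) in *.
    assert (L * tau_mesh t (j - 1) ^ 2 <= L * a ^ 2).
    { apply Rmult_le_compat_l; [lra|]. apply pow_incr. lra. }
    (* A value separating the weights: below, [5/12] is the convexity gain [1/2] less the stencil's
       [1/12]; above, the loss is at most [4/12 * L * b], and [4 b <= 5 a] is exactly what makes
       this at most [5/12 * L * a]. *)
    apply Rle_trans with (K - 5 / 12 * (L * a)).
    + apply Rmult_le_reg_r with a; [exact Hp0|].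
      unfold Rdiv at 1. rewrite Rmult_assoc, Rinv_l, Rmult_1_r by lra. nra.
    + apply Rmult_le_reg_r with b; [exact Hp1|].
      unfold Rdiv at 2. rewrite Rmult_assoc, Rinv_l, Rmult_1_r by lra.
      assert (kslope alpha (t m - t (S j)) * b ^ 2 <= 4 * L * b ^ 2).
      { apply Rmult_le_compat_r; [apply pow2_ge_0|exact HD]. }
      assert (4 * L * b ^ 2 <= 5 * (L * a) * b).
      { assert (0 <= L * b) by (apply Rmult_le_pos; lra). nra. }
      nra.
Qed.

(** Origin of the term [alpha / 12]: with [tau_n <= tau_(n+1)] and [t_(n+2) - t_n >= 2 tau_(n+1)]
    the quotient is at most [alpha / 24] times the kernel, and [(1 - alpha) (2 - alpha) <= 2]. *)
Lemma mesh_curv_penultimate_bounds (alpha : R) (t : nat -> R) (M : nat) (T : R) (n : nat) :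
  0 < alpha < 1 -> is_mesh t M T -> nearly_uniform t M -> (S (S n) <= M)%nat ->
  0 <= mesh_curv alpha t (S (S n)) n / tau_mesh t (S n) <=
    Rpower (t (S (S n)) - t n) (- alpha) / ((1 - alpha) * (2 - alpha)) * (alpha / 12).
Proof.
  intros Ha Hm Hu Hn.
  pose proof (tau_mesh_pos t M T (S n) Hm ltac:(lia)) as Hp1.
  destruct (Hu (S n) ltac:(lia) ltac:(lia)) as [Hu1 _].
  assert (Hn' : (1 <= n)%nat -> tau_mesh t n <= tau_mesh t (S n))
    by (intros; apply Hu; lia).
  destruct (mesh_curv_bounds alpha t M T (S (S n)) n Ha Hm ltac:(lia) Hn Hn') as [C1 C2].
  assert (H4 : 0 <= tau_mesh t n <= tau_mesh t (S n)).
  { destruct (Nat.eq_dec n 0) as [->|Hn0].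
    - change (tau_mesh t 0) with (t 0%nat - t 0%nat). lra.
    - specialize (Hn' ltac:(lia)).
      pose proof (tau_mesh_pos t M T n Hm ltac:(lia)). lra. }
  assert (E : t (S (S n)) - t n = tau_mesh t (S (S n)) + tau_mesh t (S n)).
  { unfold tau_mesh. rewrite !Nat.sub_1_r. cbn [Nat.pred]. ring. }
  unfold kslope in C2. rewrite E in *.
  set (X := tau_mesh t (S (S n)) + tau_mesh t (S n)) in *.
  set (a := tau_mesh t n) in *. set (b := tau_mesh t (S n)) in *.
  assert (HX : 2 * b <= X) by (unfold X; lra).
  assert (HK : 0 < Rpower X (- alpha)) by apply exp_pos.
  set (K := Rpower X (- alpha)) in *.
  split.
  - apply Rmult_le_pos; [exact C1|]. left. now apply Rinv_0_lt_compat.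
  - apply Rmult_le_reg_r with b; [exact Hp1|].
    unfold Rdiv at 1. rewrite Rmult_assoc, Rinv_l, Rmult_1_r by lra.
    apply (Rle_trans _ _ _ C2).
    assert (HaK : 0 < alpha * K) by (apply Rmult_lt_0_compat; lra).
    apply Rle_trans with (alpha * K * b / 24).
    + apply Rmult_le_reg_r with (24 * X); [lra|].
      replace (alpha * K / X * a ^ 2 / 12 * (24 * X)) with (alpha * K * (2 * a ^ 2))
        by (field; lra).
      replace (alpha * K * b / 24 * (24 * X)) with (alpha * K * (b * X)) by field.
      apply Rmult_le_compat_l; [lra|]. nra.
    + assert (Hq : / 2 <= / ((1 - alpha) * (2 - alpha)))
        by (apply Rinv_le_contravar; nra).
      unfold Rdiv.
      replace (K * / ((1 - alpha) * (2 - alpha)) * (alpha * / 12) * b) with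
        (alpha * K * b * / 12 * / ((1 - alpha) * (2 - alpha))) by ring.
      replace (alpha * K * b * / 24) with (alpha * K * b * / 12 * / 2) by field.
      apply Rmult_le_compat_l; [|exact Hq].
      apply Rmult_le_pos; [|lra]. apply Rmult_le_pos; lra.
Qed.

(** * Signs of the coefficients of the [V^j] *)

Lemma weight_last_pos (alpha : R) (t : nat -> R) (M : nat) (T : R) (m : nat) :
  0 < alpha < 1 -> is_mesh t M T -> (1 <= m <= M)%nat -> 0 < weight alpha t m m.
Proof.
  intros Ha Hm Hmm. destruct m as [|[|n]]; [lia| |].
  - apply (weight_1_pos alpha t M T); auto; lia.
  - rewrite (weight_last_eq alpha t M T) by (auto; lia).
    pose proof (tau_mesh_pos t M T (S n) Hm ltac:(lia)).
    pose proof (tau_mesh_pos t M T (S (S n)) Hm ltac:(lia)).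
    assert (0 < tau_mesh t (S n) / tau_mesh t (S (S n)))
      by (apply Rdiv_lt_0_compat; lra).
    apply Rmult_lt_0_compat; [|nra].
    apply Rdiv_lt_0_compat; [apply exp_pos|nra].
Qed.

Lemma transfer_weight_nonpos (alpha : R) (t : nat -> R) (M : nat) (T : R)
    (b : nat -> R) (m : nat) :
  0 < alpha < 1 -> is_mesh t M T -> nearly_uniform t M -> (1 <= m <= M)%nat ->
  (forall j, (1 <= j <= M)%nat -> 0 < b j < 1) ->
  (forall j, (1 <= j)%nat -> (S j <= M)%nat ->
     b (S j) <= b j /\
     defect1 alpha (tau_mesh t j / tau_mesh t (S j)) (b (S j)) < 0 /\
     defect2 alpha (tau_mesh t j / tau_mesh t (S j)) (b (S j)) < 0) ->
  forall j, (j < m)%nat -> transfer b (weight alpha t m) m (m - j) <= 0.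
Proof.
  intros Ha Hm Hu Hmm Hb Hd.
  assert (Hpen : (weight alpha t m (m - 1) <= (1 - b m) * weight alpha t m m) /\
    ((2 <= m)%nat ->
     weight alpha t m (m - 2) - weight alpha t m (m - 1)
       + b (m - 1)%nat * (weight alpha t m (m - 1)
                          - (1 - b m) * weight alpha t m m) <= 0)).
  { destruct m as [|[|n]]; [lia| |].
    - split; [|lia]. change (1 - 1)%nat with 0%nat.
      change (weight alpha t 1 0) with 0.
      pose proof (weight_1_pos alpha t M T Ha Hm ltac:(lia)).
      specialize (Hb 1%nat ltac:(lia)). apply Rmult_le_pos; lra.
    - replace (S (S n) - 1)%nat with (S n) by lia.
      replace (S (S n) - 2)%nat with n by lia.
      pose proof (weight_le_kernel alpha t M T (S (S n)) n Ha Hm Hu ltac:(lia) ltac:(lia))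
        as W.
      pose proof (mesh_curv_penultimate_bounds alpha t M T n Ha Hm Hu ltac:(lia)) as P.
      rewrite (weight_penultimate_eq alpha t M T) by (auto; lia).
      rewrite (weight_last_eq alpha t M T) by (auto; lia).
      destruct (Hd (S n) ltac:(lia) ltac:(lia)) as [Hbb [D1 D2]].
      pose proof (Hb (S n) ltac:(lia)) as Hb1.
      pose proof (Hb (S (S n)) ltac:(lia)) as Hb2.
      set (c := mesh_curv alpha t (S (S n)) n / tau_mesh t (S n)) in *.
      set (r := tau_mesh t (S n) / tau_mesh t (S (S n))) in *.
      set (b1 := b (S n)) in *. set (b2 := b (S (S n))) in *.
      set (w := weight alpha t (S (S n)) n) in *.
      assert (EC : Rpower (t (S (S n)) - t n) (- alpha) =
        Rpower (t (S (S n)) - t n) (- alpha) / ((1 - alpha) * (2 - alpha)) *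
        ((1 - alpha) * (2 - alpha))) by (field; lra).
      assert (HC : 0 < Rpower (t (S (S n)) - t n) (- alpha) / ((1 - alpha) * (2 - alpha)))
        by (apply Rdiv_lt_0_compat; [apply exp_pos|nra]).
      rewrite EC in W.
      set (C := Rpower (t (S (S n)) - t n) (- alpha) / ((1 - alpha) * (2 - alpha))) in *.
      clearbody C c r b1 b2 w. clear EC.
      unfold defect1, defect2 in *.
      assert (F1 : C * (2 - 2 * alpha - alpha / r) + c
                   - (1 - b2) * (C * (2 + alpha * r)) <= 0).
      { assert (0 <= C * - (2 - 2 * alpha - alpha / r + alpha / 12
                            - (1 - b2) * (2 + alpha * r)))
          by (apply Rmult_le_pos; lra). lra. }
      split; [lra|]. intros _.
      set (d := C * (2 - 2 * alpha - alpha / r) + c - (1 - b2) * (C * (2 + alpha * r))) in *.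
      (* Here [d] is [h_(m-1)], nonpositive by [F1], so monotonicity of [b] puts [beta_m] in place
         of [beta_(m-1)]. *)
      assert (F2 : b1 * d <= b2 * d) by nra.
      assert (F3 : 0 <= C * - ((1 - alpha) * (2 - alpha)
                     - (1 - b2) * (2 - 2 * alpha - alpha / r)
                     - b2 * (1 - b2) * (2 + alpha * r)))
        by (apply Rmult_le_pos; lra).
      (* The stencil centred at [t_(m-2)] enters the bound for [h_(m-2)] as [- (1 - b2) * c], so its
         sign suffices, whereas [F1] used its upper bound. *)
      assert (F4 : 0 <= (1 - b2) * c) by (apply Rmult_le_pos; lra).
      unfold d in F2 at 2. lra. }
  destruct Hpen as [Hp1 Hp2]. apply transfer_nonpos; [lia| |exact Hp1|exact Hp2|].
  - intros j Hj. specialize (Hb j ltac:(lia)). lra.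
  - intros j Hj. apply (weight_increasing alpha t M T); auto; lia.
Qed.

Lemma delta_eq_Vseq_sum (alpha : R) (t : nat -> R) (M : nat) (T : R)
    (b U : nat -> R) (m : nat) :
  0 < alpha < 1 -> is_mesh t M T -> (1 <= m <= M)%nat -> b 0%nat = 0 ->
  (forall j, (1 <= j <= m)%nat -> b j <> 1) ->
  delta alpha t m U =
  sum_f_R0 (fun j => / Gamma (1 - alpha) *
    ((1 - b j) * transfer b (weight alpha t m) m (m - j)) * Vseq b U j) m.
Proof.
  intros Ha Hm Hmm Hb0 Hb.
  rewrite (delta_eq_mesh_sum alpha t M T), (mesh_sum_eq_weight alpha t M T)
    by assumption.
  rewrite (weighted_increments_eq b) by (auto; reflexivity).
  rewrite scal_sum. apply sum_eq. intros j _. ring.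
Qed.

Theorem corollary2p10 (alpha theta : R)
    (halpha : 0 < alpha < 1) (htheta : / 2 <= theta <= 1) :
  (forall (T : R) (M : nat) (t : nat -> R),
      (2 <= M)%nat -> is_mesh t M T -> mesh_condition t M ->
      forall j, (1 <= j)%nat -> (j < M)%nat ->
        beta alpha theta t (S j) <= beta alpha theta t j /\
        0 < beta alpha theta t (S j)) /\
  (exists sbar : R, 0 < sbar < 1 /\
    forall (T : R) (M : nat) (t : nat -> R),
      (2 <= M)%nat -> is_mesh t M T -> mesh_condition t M ->
      (forall j, (2 <= j <= M)%nat -> 0 <= sigma_mesh t j <= sbar) ->
      (forall j, (1 <= j <= M)%nat -> 0 < beta alpha theta t j < 1) /\
      (exists kappa : nat -> nat -> R,
          represents alpha t M (beta alpha theta t) kappa) /\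
      (forall kappa : nat -> nat -> R,
          represents alpha t M (beta alpha theta t) kappa ->
          (forall m, (1 <= m <= M)%nat ->
              0 < kappa m m /\ sum_f_R0 (fun j => kappa m j) m = 0) /\
          (forall m j, (j < m)%nat -> (m <= M)%nat -> kappa m j <= 0))).
Proof.
  split.
  { intros T M t _ Hm Hc j Hj HjM. now apply (beta_decreasing alpha theta t M T). }
  destruct (defects_near_uniform_mesh alpha theta halpha htheta)
    as [sbar [Hsbar Hdef]].
  exists sbar. split; [lra|].
  intros T M t HM Hm Hc Hs.
  set (b := beta alpha theta t).
  assert (Hb : forall j, (1 <= j <= M)%nat -> 0 < b j < 1).
  { intros j Hj. unfold b. rewrite beta_eq by lia.
    specialize (Hs (Nat.max 2 j) ltac:(lia)).
    split; [apply beta_of_sigma_pos | apply beta_of_sigma_lt1]; try tauto; lra. }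
  split; [exact Hb|].
  assert (Hb1 : forall m j, (m <= M)%nat -> (1 <= j <= m)%nat -> b j <> 1).
  { intros m j HmM Hj. specialize (Hb j ltac:(lia)). lra. }
  set (kappa0 := fun m j => / Gamma (1 - alpha) *
    ((1 - b j) * transfer b (weight alpha t m) m (m - j))).
  assert (Hrep : represents alpha t M b kappa0).
  { intros m U Hmm.
    apply (delta_eq_Vseq_sum alpha t M T); auto.
    intros j Hj. apply (Hb1 m); lia. }
  split; [now exists kappa0|].
  intros kappa Hk.
  assert (HG : 0 < / Gamma (1 - alpha)) by now apply Rinv_0_lt_compat, Gamma_pos.
  assert (Heq : forall m j, (1 <= m <= M)%nat -> (j <= m)%nat ->
                  kappa m j = kappa0 m j).
  { intros m j Hmm. apply (Vseq_coefficients_unique b (kappa m) (kappa0 m) m).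
    - intros i Hi. apply (Hb1 m); lia.
    - intros U. now rewrite <- (Hk m U Hmm), <- (Hrep m U Hmm). }
  assert (Hb01 : forall j, (j <= M)%nat -> 0 < 1 - b j).
  { intros j Hj. destruct j as [|j]; [unfold b, beta; lra|].
    specialize (Hb (S j) ltac:(lia)). lra. }
  split.
  - intros m Hmm. split.
    + rewrite Heq by lia. unfold kappa0. rewrite Nat.sub_diag. cbn [transfer].
      pose proof (weight_last_pos alpha t M T m halpha Hm Hmm).
      specialize (Hb01 m ltac:(lia)).
      apply Rmult_lt_0_compat; [exact HG|]. now apply Rmult_lt_0_compat.
    (* For constant mesh values [1] every [V^j] is [1], while all increments vanish. *)
    + transitivity (delta alpha t m (fun _ => 1)).
      * rewrite (Hk m _ Hmm). apply sum_eq. intros j Hj.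
        rewrite (Vseq_const b m j); [ring| |exact Hj].
        intros i Hi. apply (Hb1 m); lia.
      * rewrite (delta_eq_mesh_sum alpha t M T), (mesh_sum_eq_weight alpha t M T)
          by assumption.
        rewrite (sum_eq _ (fun _ => 0)) by (intros; ring).
        rewrite sum_cte. ring.
  - intros m j Hj HmM. rewrite Heq by lia. unfold kappa0.
    assert (HT : transfer b (weight alpha t m) m (m - j) <= 0).
    { apply (transfer_weight_nonpos alpha t M T); auto; [|lia|].
      - intros k Hk1 Hk2.
        pose proof (tau_mesh_of_sigma t M T k sbar Hm Hk1 Hk2 (Hs (S k) ltac:(lia)))
          as [H1 H2].
        pose proof (tau_mesh_pos t M T k Hm ltac:(lia)).
        pose proof (tau_mesh_pos t M T (S k) Hm ltac:(lia)).
        split; [exact H1|nra].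
      - intros k Hk1 Hk2.
        destruct (beta_decreasing alpha theta t M T k halpha htheta Hm Hc Hk1 Hk2)
          as [H1 _].
        split; [exact H1|].
        rewrite <- (ratio_of_sigma_mesh t M T) by assumption.
        unfold b. rewrite beta_eq by lia.
        replace (Nat.max 2 (S k)) with (S k) by lia.
        apply Hdef, Hs. lia. }
    specialize (Hb01 j ltac:(lia)).
    assert (0 <= (1 - b j) * - transfer b (weight alpha t m) m (m - j))
      by (apply Rmult_le_pos; lra).
    assert (0 <= / Gamma (1 - alpha) *
                 ((1 - b j) * - transfer b (weight alpha t m) m (m - j)))
      by (apply Rmult_le_pos; lra).
    lra.
Qed.
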